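(* Let $(\mathcal G,\lambda)$ be a locally compact semigroupoid with quasi-Haar system $\lambda$. 1) If $(\mathcal G,\lambda)$ is Liouville, then it is Reiter. 2) If $(\mathcal G,\lambda)$ is tight Liouville, then it is tight Reiter. 3) If $(\mathcal G,\lambda)$ is continuous Liouville, then it is uniform Reiter.
   Context: A semigroupoid is a small category: a set $\mathcal G$ of morphisms, a set $\mathcal G^{(0)}$ of objects (units), surjective source and target maps $\mathbf s,\mathbf t:\mathcal G\to\mathcal G^{(0)}$, and a composition $(\zeta,\eta)\mapsto\zeta\eta$ on $\mathcal G^{(2)}=\{(\zeta,\eta)\in\mathcal G^2:\mathbf s(\zeta)=\mathbf t(\eta)\}$. Units are identified with identity morphisms, so $\mathcal G^{(0)}\subseteq\mathcal G$. For $x\in\mathcal G^{(0)}$ put $\mathcal G^x=\mathbf t^{-1}(x)$. A topological semigroupoid is a semigroupoid with a topology on $\mathcal G$ such that the composition, $\mathbf s$ and $\mathbf t$ are continuous. A locally compact semigroupoid is a topological semigroupoid which is locally compact, Hausdorff and second countable. A continuous system of measures on $\mathcal G$ is a family $\lambda=(\lambda^x)_{x\in\mathcal G^{(0)}}$ of nonzero $\sigma$-finite positive Radon measures $\lambda^x$ on $\mathcal G^x$ (regarded also as measures on $\mathcal G$ vanishing outside $\mathcal G^x$) such that $x\mapsto\int f\,d\lambda^x$ is continuous for every $f\in C_c(\mathcal G)$. For $\gamma\in\mathcal G$ and a measure $\rho$ on $\mathcal G^{\mathbf s(\gamma)}$, $\gamma\rho$ is the pushforward of $\rho$ under $\mathcal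 G^{\mathbf s(\gamma)}\to\mathcal G^{\mathbf t(\gamma)}$, $\eta\mapsto\gamma\eta$; $\prec$ denotes absolute continuity. A quasi-Haar system is a continuous system of measures $\lambda$ such that $\gamma\lambda^{\mathbf s(\gamma)}\prec\lambda^{\mathbf t(\gamma)}$ for all $\gamma$ and $(\gamma,\eta)\in\mathcal G^2\mapsto\frac{d(\gamma\lambda^{\mathbf s(\gamma)})}{d\lambda^{\mathbf t(\gamma)}}(\eta)\in[0,\infty]$ is Borel. A continuous system $\theta=(\theta^x)_x$ of probability measures $\theta^x$ on $\mathcal G^x$ is $\lambda$-adapted if $\theta^x\prec\lambda^x$ for every $x$ and $(\gamma,\eta)\in\mathcal G^2\mapsto\frac{d(\gamma\theta^{\mathbf s(\gamma)})}{d\lambda^{\mathbf t(\gamma)}}(\eta)\in[0,\infty]$ is Borel. For $K\subseteq\mathcal G^{(0)}$ compact, $\mathrm{supp}_K(\theta)=\overline{\bigcup_{x\in K}\mathrm{supp}\,\theta^x}$. $\|\cdot\|$ is the total variation norm. Consider a sequence $(\theta_n)_n$ of $\lambda$-adapted continuous systems of probability measures and the condition (R): $\lim_{n\to\infty}\|\theta_n^{\mathbf t(\gamma)}-\gamma\theta_n^{\mathbf s(\gamma)}\|=0$ for all $\gamma\in\mathcal G$. $(\mathcal G,\lambda)$ is Reiter if there is a sequence satisfying (R); uniform Reiter if there is a sequence for which the convergence in (R) is uniform on compact subsets of $\mathcal G$; tight Reiter if there is a sequence satisfying (R) such that $\mathrm{supp}_K(\theta_n)$ is compact for every $n$ and every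 compact $K\subseteq\mathcal G^{(0)}$. For a $\lambda$-adapted continuous system of probability measures $\pi=(\pi_x)_x$, define $P_x$ on $L^\infty(\mathcal G^x,\lambda^x)$ by $P_x(f)(\zeta)=\int_{\mathcal G^{\mathbf s(\zeta)}}f(\zeta\eta)\,d\pi_{\mathbf s(\zeta)}(\eta)$, and $H_{\pi,x}(\mathcal G)=\{f\in L^\infty(\mathcal G^x,\lambda^x):P_x(f)=f\}$. $(\mathcal G,\lambda)$ is Liouville if there is a $\lambda$-adapted continuous system of probability measures $\pi$ with $H_{\pi,x}(\mathcal G)=\mathbb C\mathbf 1$ (the constants) for all $x\in\mathcal G^{(0)}$; it is continuous Liouville if such a $\pi$ exists for which in addition $(\gamma,\eta)\in\mathcal G^2\mapsto\frac{d(\gamma\pi_{\mathbf s(\gamma)})}{d\lambda^{\mathbf t(\gamma)}}(\eta)\in\mathbb R$ is bounded and continuous; it is tight Liouville if such a $\pi$ exists for which in addition $\mathrm{supp}_K(\pi)$ is compact for every compact $K\subseteq\mathcal G^{(0)}$. *)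

(* Defs.v *)
From HB Require Import structures.
From mathcomp Require Import all_boot all_order all_algebra.
From mathcomp Require Import all_classical all_reals all_analysis.
From mathcomp Require Import measurable_realfun.
From mathcomp Require Import complex.

Set Implicit Arguments.
Unset Strict Implicit.
Unset Printing Implicit Defensive.

Import Order.TTheory GRing.Theory Num.Theory.
Import numFieldNormedType.Exports.

Local Open Scope classical_set_scope.
Local Open Scope ring_scope.

(* Units are identified with identity morphisms, so they form a subset of [G].
   [comp] is a total function whose values are meaningful only on composable
   pairs (source of the left factor = target of the right factor); nothing is
   assumed about the other values. *)
Record semigroupoid (G : Type) := Semigroupoid {
  units : set G;
  src : G -> G;
  tgt : G -> G;
  comp : G -> G -> G;
  range_src : range src = units;
  range_tgt : range tgt = units;
  src_unit : forall x, units x -> src x = x;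
  tgt_unit : forall x, units x -> tgt x = x;
  src_comp : forall z e, src z = tgt e -> src (comp z e) = src e;
  tgt_comp : forall z e, src z = tgt e -> tgt (comp z e) = tgt z;
  compA : forall z e k, src z = tgt e -> src e = tgt k ->
    comp z (comp e k) = comp (comp z e) k;
  comp_tgt : forall z, comp (tgt z) z = z;
  comp_src : forall z, comp z (src z) = z
}.

Definition composable (G : Type) (S : semigroupoid G) : set (G * G) :=
  [set p | src S p.1 = tgt S p.2].

Definition fiber (G : Type) (S : semigroupoid G) (x : G) : set G :=
  [set z | tgt S z = x].

Definition topological_semigroupoid (G : topologicalType)
    (S : semigroupoid G) : Prop :=
  [/\ continuous (src S), continuous (tgt S)
    & {within composable S, continuous (fun p : G * G => comp S p.1 p.2)}].

Definition locally_compact_semigroupoid (G : topologicalType)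
    (S : semigroupoid G) : Prop :=
  [/\ topological_semigroupoid S, locally_compact [set: G],
      hausdorff_space G & @second_countable G].

Notation borelType G := (g_sigma_algebraType (@open G)).

Section Measures.
Context (R : realType) (G : ptopologicalType).
Implicit Types (mu : {measure set (borelType G) -> \bar R})
  (nu : set (borelType G) -> \bar R).

Definition radon mu : Prop :=
  [/\ forall K : set G, compact K -> (mu K < +oo)%E,
      forall A : set (borelType G), measurable A ->
        mu A = ereal_inf [set mu U | U in [set U : set G | open U /\ A `<=` U]]
    & forall U : set G, open U ->
        mu U = ereal_sup [set mu K | K in [set K : set G | compact K /\ K `<=` U]]].

Definition msupport mu : set G :=
  [set y | forall U : set G, open U -> U y -> (0 < mu U)%E].

(* The library's ['d nu '/d mu] requires a finite charge [nu]; here the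
   derivative may take the value [+oo]. *)
Definition is_RN_derivative nu mu (f : borelType G -> \bar R) : Prop :=
  [/\ measurable_fun [set: borelType G] f,
      forall y, (0 <= f y)%E
    & forall A : set (borelType G), measurable A ->
        nu A = (\int[mu]_(y in A) f y)%E].

Definition tv_norm nu : \bar R :=
  ereal_sup [set r | exists n (A : 'I_n -> set (borelType G)),
    [/\ forall i, measurable (A i), trivIset setT A
      & r = (\sum_(i < n) `|nu (A i)|)%E]].

End Measures.

Section Systems.
Context (R : realType) (G : ptopologicalType) (S : semigroupoid G).
Implicit Types (lambda rho : G -> {measure set (borelType G) -> \bar R})
  (theta pi : G -> probability (borelType G) R).

(* Systems are indexed by all of [G], but only the measures at units are
   constrained.  The measure at [x] is a Borel measure on [G] that vanishes
   outside the fiber over [x].  Real-valued test functions suffice by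
   linearity of the integral. *)
Definition continuous_system lambda : Prop :=
  (forall x, units S x ->
     [/\ lambda x (~` fiber S x) = 0%E, lambda x setT <> 0%E,
         sigma_finite setT (lambda x) & radon (lambda x)]) /\
  (forall f : G -> R, continuous f -> compact (closure [set y | f y != 0]) ->
     {within units S, continuous (fun x => \int[lambda x]_y f y)}).

(* Push-forward of a measure on the fiber over [src S g] under left
   multiplication by [g]; the intersection discards non-composable pairs. *)
Definition translate (g : G) (nu : set (borelType G) -> \bar R) :
    set (borelType G) -> \bar R :=
  fun A => nu (fiber S (src S g) `&` comp S g @^-1` A).

(* Radon-Nikodym derivatives are only defined almost everywhere: [D] chooses,
   for every [g], a version of the derivative of [g rho^(s g)] with respect to
   [lambda^(t g)]. *)
Definition joint_RN_derivative rho lambda (D : G * G -> \bar R) : Prop :=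
  forall g, is_RN_derivative (translate g (rho (src S g))) (lambda (tgt S g))
              (fun e => D (g, e)).

Definition has_borel_RN_derivative rho lambda : Prop :=
  exists2 D : borelType (G * G)%type -> \bar R,
    measurable_fun [set: borelType (G * G)%type] D
    & joint_RN_derivative rho lambda D.

Definition quasi_haar lambda : Prop :=
  [/\ continuous_system lambda,
      forall g, translate g (lambda (src S g)) `<< lambda (tgt S g)
    & has_borel_RN_derivative lambda lambda].

Definition adapted lambda theta : Prop :=
  [/\ continuous_system theta,
      forall x, units S x -> theta x `<< lambda x
    & has_borel_RN_derivative theta lambda].

Definition supp_over theta (K : set G) : set G :=
  closure (\bigcup_(x in K) msupport (theta x)).

Definition tight theta : Prop :=
  forall K : set G, K `<=` units S -> compact K -> compact (supp_over theta K).

Definition reiter_defect theta (g : G) : \bar R :=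
  tv_norm (fun A => theta (tgt S g) A - translate g (theta (src S g)) A)%E.

Definition reiter_sequence (theta : nat -> G -> probability (borelType G) R) :
    Prop :=
  forall g, (fun n => reiter_defect (theta n) g) @ \oo --> (0 : \bar R)%E.

Definition uniform_reiter_sequence
    (theta : nat -> G -> probability (borelType G) R) : Prop :=
  forall K : set G, compact K -> forall e : R, 0 < e ->
    \forall n \near \oo, forall g, K g -> (reiter_defect (theta n) g < e%:E)%E.

Definition reiter lambda : Prop :=
  exists2 theta : nat -> G -> probability (borelType G) R,
    forall n, adapted lambda (theta n) & reiter_sequence theta.

Definition uniform_reiter lambda : Prop :=
  exists2 theta : nat -> G -> probability (borelType G) R,
    forall n, adapted lambda (theta n) & uniform_reiter_sequence theta.

Definition tight_reiter lambda : Prop :=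
  exists theta : nat -> G -> probability (borelType G) R,
    [/\ forall n, adapted lambda (theta n), reiter_sequence theta
      & forall n, tight (theta n)].

(* Representatives of elements of the complex space L^oo(G^x, lambda^x); since
   [lambda x] vanishes outside the fiber they may be taken on all of [G]. *)
Definition Linfty (mu : {measure set (borelType G) -> \bar R}) :
    set (G -> R[i]) :=
  [set f | (fun y => complex.Re (f y)) \in Lfun mu +oo%E /\
           (fun y => complex.Im (f y)) \in Lfun mu +oo%E].

Definition averaging pi (f : G -> R[i]) (z : G) : R[i] :=
  Complex
    (\int[pi (src S z)]_(e in fiber S (src S z)) complex.Re (f (comp S z e)))
    (\int[pi (src S z)]_(e in fiber S (src S z)) complex.Im (f (comp S z e))).

Definition harmonic lambda pi (x : G) : set (G -> R[i]) :=
  [set f | Linfty (lambda x) f /\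
           {ae lambda x, forall z, averaging pi f z = f z}].

Definition constants (mu : {measure set (borelType G) -> \bar R}) :
    set (G -> R[i]) :=
  [set f | Linfty mu f /\ exists c : R[i], {ae mu, forall z, f z = c}].

Definition liouville_system lambda pi : Prop :=
  adapted lambda pi /\
  forall x, units S x -> harmonic lambda pi x = constants (lambda x).

Definition has_bounded_continuous_RN_derivative rho lambda : Prop :=
  exists D : G * G -> R,
    [/\ continuous D, exists M : R, forall p, `|D p| <= M
      & joint_RN_derivative rho lambda (EFin \o D)].

Definition liouville lambda : Prop :=
  exists pi, liouville_system lambda pi.

Definition continuous_liouville lambda : Prop :=
  exists2 pi, liouville_system lambda pi
    & has_bounded_continuous_RN_derivative pi lambda.

Definition tight_liouville lambda : Prop :=
  exists2 pi, liouville_system lambda pi & tight pi.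

End Systems.

(* Main.v *)
(* Translating [pi] gives a Markov kernel [k] on [G], [k g] being the push-forward
   of [pi] at [src g] under left multiplication by [g]; it preserves fibers and
   commutes with left translations.  Let [theta_n^x] be the Cesaro average of the
   first [n+1] powers of [k] started at [x].  Left translation by [g] turns
   [theta_n] at [src g] into the same average started at [g], so the Reiter
   condition says that the averages started at [tgt g] and at [g] merge.  If they
   did not, the sets of [0,1]-valued functions [f] with [|k f - f| <= 1/(N+1)] and
   a fixed gap between the values of [k f] at the two points would be nonempty for
   all [N]; they are convex and decrease with [N], and elements of nearly minimal
   L^2 norm (for a finite measure equivalent to [lambda]) converge almost
   everywhere to a harmonic function which still has the gap, contradicting the
   Liouville property.
   For uniformity, the gap between the sums of the first [n] powers is subadditive
   in [n], and it is governed by the overlap of two densities, which is lower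
   semicontinuous in [g] when the density of [pi] is continuous: a good estimate
   at [g] for one [n] therefore persists near [g] and for all large [n].
   For tightness, the powers of a tight kernel started in a compact set are carried
   by compact sets. *)

Require Import Defs.
From HB Require Import structures.
From mathcomp Require Import all_boot all_order all_algebra.
From mathcomp Require Import all_classical all_reals all_analysis.
From mathcomp Require Import measurable_realfun ess_sup_inf giry complex ring lra.

Set Implicit Arguments.
Unset Strict Implicit.
Unset Printing Implicit Defensive.

Import Order.TTheory GRing.Theory Num.Theory.
Import numFieldNormedType.Exports.

Local Open Scope classical_set_scope.
Local Open Scope ring_scope.

(** Single points of a fiber may be [lambda]-null, so an almost everywhere limit says nothing about
    values at them. This is why the gap is imposed on [markov k f] and not on [f]: each [k z] is
    absolutely continuous with respect to [lambda (tgt S z)], hence [markov k f z] depends only on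
    the class of [f] and passes to almost everywhere limits at every single [z]. For the same reason
    the averages begin with the first power of [k], the zeroth being a Dirac mass. Almost harmonic
    functions come from a failure of merging: [k] moves the sum of the first [n] iterates of [f]
    only by its two end terms, so it moves their mean by at most [1 / n]. A compactly supported test
    function composed with a left translation need not have compact support, so vague continuity
    does not compose directly. All continuity therefore goes through lower semicontinuity of the
    mass of open sets, which survives composition of kernels; constancy of the total mass turns it
    back into continuity at the end. *)

Local Notation comp := Defs.comp.

(** * Locally compact second countable spaces *)

(** Replaces the extraction and recombination of finite subcovers: Urysohn functions, the tube lemma
    and the uniform estimate over a compact set are all local statements glued through unions. *)
Lemma compact_union_ind (T : topologicalType) (K : set T) (Q : set T -> Prop) :
  compact K -> Q set0 -> (forall A B, Q A -> Q B -> Q (A `|` B)) ->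
  (forall A B, A `<=` B -> Q B -> Q A) ->
  (forall x, K x -> exists2 N, nbhs x N & Q N) -> Q K.
Proof.
move=> /compact_near_coveringP cK Q0 QU Qmono Qloc.
(* Along [F] a set [B] eventually contains any prescribed set satisfying [Q]. Near covering shows
   that [B] eventually contains [K]; taking for [B] the base set [A] itself puts [K] inside a set
   satisfying [Q]. *)
pose F : set_system (set T) := [set X | exists2 A, Q A & forall B, A `<=` B -> X B].
have FF : Filter F.
  split; first by exists set0.
    move=> X Y [A QA AX] [B QB BY]; exists (A `|` B); first exact: QU.
    by move=> C; rewrite subUset => -[AC BC]; split; [exact: AX|exact: BY].
  by move=> X Y XY [A QA AX]; exists A => // B /AX/XY.
have [x Kx|A QA AK] := cK _ F (fun B x => B x) FF _; last exact: (Qmono _ _ (AK A _)).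
have [N Nx QN] := Qloc _ Kx.
exists (N, [set B | N `<=` B]) => /=; first by split=> //; exists N.
by move=> [y B] /= [Ny NB]; exact: NB.
Qed.

Section LocallyCompact.
Context (R : realType) (T : topologicalType).
Hypotheses (lcT : locally_compact [set: T]) (hT : hausdorff_space T).

Lemma compact_urysohn (K V : set T) : compact K -> open V -> K `<=` V ->
  exists f : T -> R, [/\ continuous f, (forall x, 0 <= f x <= 1),
    (forall x, K x -> f x = 1), (forall x, ~ V x -> f x = 0)
    & compact (closure [set y | f y != 0])].
Proof.
move=> cK oV KV.
(* The bound 1/2 is what complete regularity gives on a neighbourhood of a point, and it survives
   maxima; [Num.min 1 (2 * f x)] restores the value 1 on [K]. *)
pose Q (A : set T) := exists f : T -> R, [/\ continuous f,
  (forall x, 0 <= f x <= 1), (forall x, A x -> 2^-1 <= f x),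
  (forall x, ~ V x -> f x = 0) & compact (closure [set y | f y != 0])].
suff [f [cf f01 fK fV fc]] : Q K.
  exists (fun x => Num.min 1 (2 * f x)); split.
  - move=> x; apply: (@continuous_min R T (cst 1) (fun x => 2 * f x)).
      exact: cst_continuous.
    by apply: continuousM; [exact: cst_continuous|exact: cf].
  - by move=> x; have /andP[f0 f1] := f01 x; rewrite le_min ler01 mulr_ge0//= ge_min lexx.
  - move=> x /fK fx; apply/min_idPl.
    rewrite /= in fx *; lra.
  - by move=> x /fV ->; rewrite mulr0; apply/min_idPr; exact: ler01.
  - apply: (subclosed_compact (@closed_closure _ _) fc).
    apply: closureS => x /=; apply: contra => /eqP ->.
    by rewrite mulr0; apply/eqP/min_idPr; exact: ler01.
apply: (compact_union_ind cK).
- exists (fun=> 0); split => //; first by move=> x; exact: cvg_cst.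
    by move=> x; rewrite lexx ler01.
  rewrite (_ : [set _ | _] = set0) ?closure0; first exact: compact0.
  by apply/seteqP; split => // x /=; rewrite eqxx.
- move=> A B [f [cf f01 fA fV fc]] [g [cg g01 gA gV gc]].
  exists (fun x => Num.max (f x) (g x)); split.
  + by move=> x; apply: (@continuous_max R T f g); [exact: cf|exact: cg].
  + move=> x; have /andP[f0 f1] := f01 x; have /andP[g0 g1] := g01 x.
    by rewrite le_max f0 ge_max f1 g1.
  + by move=> x [/fA|/gA] h; rewrite le_max h ?orbT.
  + by move=> x nVx; rewrite fV// gV// maxxx.
  + have := compactU fc gc; rewrite -closureU => h.
    apply: (subclosed_compact (@closed_closure _ _) h).
    apply: closureS => x /=; have [->|fx _] := eqVneq (f x) 0; last by left.
    have [->|gx _] := eqVneq (g x) 0; last by right.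
    by rewrite maxxx eqxx.
- move=> A B AB [f [cf f01 fB fV fc]]; exists f; split => //.
  by move=> x /AB; exact: fB.
move=> x Kx.
have [W] := lcT (x := x) I; rewrite withinET => Wx [cW clW].
(* Separating [x] from the complement of [N] makes [1 - f] vanish both off [V] and off the compact
   neighbourhood [W], which bounds its support. *)
pose N := W° `&` V.
have oN : open N by apply: openI => //; exact: open_interior.
have Nx : N x by split; [exact: Wx|exact: KV].
have /(@uniform_separatorP _ R)[f [cf f01 fx fN]] :=
  @locally_compact_completely_regular T R lcT hT x (~` N) (open_closedC oN)
    (fun h => h Nx).
have {fx}fx : f x = 0 by apply: fx; exists x.
have {}fN y : ~ N y -> f y = 1 by move=> Ny; apply: fN; exists y.
have {}f01 y : 0 <= f y <= 1 by have := f01 (f y); rewrite /= in_itv/=; apply; exists y.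
have cg : continuous (fun y => 1 - f y).
  by move=> y; apply: cvgB; [exact: cvg_cst|exact: cf].
exists [set y | 2^-1 <= 1 - f y].
  have : \forall y \near x, 2^-1 < 1 - f y.
    apply: (cvgr_gt (1 - f x) (cg x)); rewrite fx subr0.
    by rewrite invf_lt1// ltr1n.
  by apply: filterS => y /= /ltW.
exists (fun y => 1 - f y); split => //.
- by move=> y; have /andP[f0 f1] := f01 y; rewrite subr_ge0 f1 gerBl f0.
- by move=> y nVy; rewrite fN ?subrr// => -[].
- apply: (subclosed_compact (@closed_closure _ _) cW).
  rewrite [X in _ `<=` X](closure_id W).1//; apply: closureS => y /=.
  apply: contraPP => nWy; rewrite fN ?subrr ?eqxx//.
  by move=> [/interior_subset].
Qed.

Lemma compact_nbhs_sub (x : T) (U : set T) : open U -> U x ->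
  exists2 K, compact K /\ nbhs x K & K `<=` U.
Proof.
move=> oU Ux; have [f [cf f01 f1 fU fc]] := compact_urysohn (@compact_set1 _ x) oU
  (fun y (yx : [set x] y) => eq_ind_r U Ux yx).
have cc : closed [set y | 2^-1 <= f y].
  exact: (closed_comp (fun y _ => cf y) (@closed_ge _ _)).
exists [set y | 2^-1 <= f y]; last first.
  move=> y /=; apply: contraPP => /fU ->.
  by apply/negP; rewrite -ltNge invr_gt0.
split.
  apply: (subclosed_compact cc fc) => y /= fy; apply: subset_closure => /=.
  by rewrite gt_eqF// (lt_le_trans _ fy)// invr_gt0.
have : \forall y \near x, 2^-1 < f y.
  apply: (cvgr_gt (f x) (cf x)); rewrite f1//.
  by rewrite invf_lt1// ltr1n.
by apply: filterS => y /= /ltW.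
Qed.

(** The basic open sets that admit a compact set between themselves and [U] already cover [U], and
    there are countably many of them. *)
Lemma open_sigma_compact (U : set T) : @second_countable T -> open U ->
  exists2 K : nat -> set T, (forall n, compact (K n)) & U = \bigcup_n K n.
Proof.
move=> [B cB [_ bB]] oU.
pose D := [set b | B b /\ exists2 K, compact K & b `<=` K /\ K `<=` U].
have cD : countable D by apply: sub_countable cB; apply: subset_card_le => b [].
have h b : exists K, D b -> [/\ compact K, b `<=` K & K `<=` U].
  have [[_ [K cK [bK KU]]]|nD] := pselect (D b); first by exists K.
  by exists set0.
have [k hk] := choice h.
have [D0|/set0P D0] := eqVneq D set0.
  exists (fun=> set0) => //; first by move=> _; exact: compact0.
  rewrite bigcup0//; apply/seteqP; split => // x Ux.
  have [K [cK Kx] KU] := compact_nbhs_sub oU Ux.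
  have [b [Bb bx] bK] := bB _ _ Kx.
  by suff: D b; [rewrite D0|split => //; exists K].
have /pfcard_geP[|[e]] := cD; first by move=> De; move: D0; rewrite De => -[].
have De n : D (e n) by apply: (@funS _ _ _ _ e).
exists (k \o e).
  by move=> n; have [] := hk (e n) (De n).
apply/seteqP; split => [x Ux|x [n _] /=]; last first.
  by have [_ _] := hk (e n) (De n); apply.
have [K [cK Kx] KU] := compact_nbhs_sub oU Ux.
have [b [Bb bx] bK] := bB _ _ Kx.
have Db : D b by split => //; exists K.
have [n _ en] := @surj _ _ _ _ e b Db.
by exists n => //=; rewrite en; have [_ + _] := hk b Db; apply.
Qed.

End LocallyCompact.

Lemma compact_tube (T1 T2 : topologicalType) (x : T1) (K : set T2)
    (O : set (T1 * T2)) : compact K -> open O -> (forall y, K y -> O (x, y)) ->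
  exists N V, [/\ nbhs x N, open V, K `<=` V & N `*` V `<=` O].
Proof.
move=> cK oO KO.
pose Q (A : set T2) := exists N V, [/\ nbhs x N, open V, A `<=` V & N `*` V `<=` O].
apply: (compact_union_ind (Q := Q) cK).
- exists setT, set0; split => //; [exact: filterT|exact: open0|].
  by move=> [y z] [].
- move=> A B [N [V [Nx oV AV NV]]] [N' [V' [Nx' oV' BV NV']]].
  exists (N `&` N'), (V `|` V'); split; [exact: filterI|exact: openU|exact: setUSS|].
  by move=> [y z] [/= [Ny N'y] [Vz|V'z]]; [exact: NV|exact: NV'].
- move=> A B AB [N [V [Nx oV BV NV]]]; exists N, V; split => //.
  exact: subset_trans BV.
move=> y Ky.
have [[N V] /= [Nx Vy] NVO] : nbhs (x, y) O by apply: open_nbhs_nbhs; split => //; exact: KO.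
exists (V°); first exact: nbhs_interior.
exists N, V°; split => //; first exact: open_interior.
by move=> [a b] [/= Na /interior_subset Vb]; exact: NVO.
Qed.

Lemma pairl_continuous (T1 T2 : topologicalType) (x : T1) :
  continuous (fun y : T2 => (x, y)).
Proof. by move=> y; apply: cvg_pair; [exact: cvg_cst|exact: cvg_id]. Qed.

(** * Lower semicontinuity and Borel families of measures *)

Section LowerSemicontinuous.
Context (R : realType) (X : topologicalType).
Local Open Scope ereal_scope.
Implicit Types f g : X -> \bar R.

Lemma lscD f g : (forall x, 0 <= f x) -> (forall x, 0 <= g x) ->
  lower_semicontinuous f -> lower_semicontinuous g ->
  lower_semicontinuous (fun x => f x + g x).
Proof.
move=> f0 g0 lf lg x a afg.
(* The strict slack is divided between the two summands; if just one is infinite, the finite one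
   gives up a unit and the infinite one takes the rest. *)
suff [b [c [bf cg abc]]] : exists b c : R,
    [/\ b%:E < f x, c%:E < g x & (a <= b + c)%R].
  have [A Ax Af] := lf x b bf; have [B Bx Bg] := lg x c cg.
  exists (A `&` B); first exact: filterI.
  move=> y [/Af fy /Bg gy]; apply: (@le_lt_trans _ _ (b + c)%:E).
    by rewrite lee_fin.
  by rewrite EFinD lteD.
have := f0 x; have := g0 x; case: (f x) afg => [u| |]; case: (g x) => [v| |]//=.
- rewrite -EFinD lte_fin => auv _ _.
  exists (u - (u + v - a) / 2)%R, (v - (u + v - a) / 2)%R.
  by split; rewrite ?lte_fin; lra.
- move=> _ _ _; exists (u - 1)%R, (a - u + 1)%R; rewrite ltry lte_fin; split => //; lra.
- move=> _ _ _; exists (a - v + 1)%R, (v - 1)%R; rewrite ltry lte_fin; split => //; lra.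
- by move=> _ _ _; exists 0%R, a; rewrite !ltry add0r.
Qed.

Lemma lsc_sum (I : Type) (s : seq I) (f : I -> X -> \bar R) :
  (forall i x, 0 <= f i x) -> (forall i, lower_semicontinuous (f i)) ->
  lower_semicontinuous (fun x => \sum_(i <- s) f i x).
Proof.
move=> f0 lf; elim: s => [|i s IH].
  by move=> x a; rewrite big_nil => a0; exists setT; [exact: filterT|move=> y _; rewrite big_nil].
rewrite (_ : (fun _ => _) = (fun x => f i x + \sum_(j <- s) f j x)).
  by apply: lscD => // x; apply: sume_ge0.
by apply/funext => x; rewrite big_cons.
Qed.

Lemma lscZ (r : R) f : (0 < r)%R -> lower_semicontinuous f ->
  lower_semicontinuous (fun x => r%:E * f x).
Proof.
move=> r0 lf x a; rewrite -lte_pdivrMl// -EFinM => /lf[V Vx Vf].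
by exists V => // y /Vf; rewrite EFinM lte_pdivrMl.
Qed.

Lemma lsc_mine f g : lower_semicontinuous f -> lower_semicontinuous g ->
  lower_semicontinuous (fun x => mine (f x) (g x)).
Proof.
move=> lf lg x a; rewrite lt_min => /andP[/lf[A Ax Af] /lg[B Bx Bg]].
exists (A `&` B); first exact: filterI.
by move=> y [/Af fy /Bg gy]; rewrite lt_min fy.
Qed.

Lemma lsc_comp (Y : topologicalType) (c : Y -> X) f : continuous c ->
  lower_semicontinuous f -> lower_semicontinuous (f \o c).
Proof.
move=> cc lf y a /lf[A Ay Af]; exists (c @^-1` A); first exact: cc.
by move=> z /= /Af.
Qed.

End LowerSemicontinuous.

Lemma ereal_cvg_exists_gt (R : realType) (u : (\bar R)^nat) (l a : \bar R) :
  u n @[n --> \oo] --> l -> (a < l)%E -> exists n, (a < u n)%E.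
Proof.
move=> ul; apply: contraPP => /forallNP nau; apply/negP; rewrite -leNgt.
by apply: (cvge_le _ ul); apply: nearW => n; rewrite leNgt; exact/negP.
Qed.

(** * Layer-cake approximation of extended nonnegative numbers *)

Section Layers.
Context (R : realType).
Local Open Scope ereal_scope.

(** With [m = n.+1], the [m ^ 2] levels are spaced by [1 / m] and reach height [m], so mesh and
    cutoff improve together. The comparison is strict so that, for a lower semicontinuous integrand,
    each layer is an open set. *)
Definition layers (n : nat) (t : \bar R) : R :=
  (\sum_(j < n.+1 ^ 2) n.+1%:R^-1 * ((j.+1%:R / n.+1%:R)%:E < t)%E%:R)%R.

Let layers_bounds (m N : nat) (t : \bar R) : (0 < m)%N -> 0 <= t ->
  let s := (\sum_(j < N) m%:R^-1 * ((j.+1%:R / m%:R)%:E < t)%E%:R)%R in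
  s%:E <= mine t (N%:R / m%:R)%:E /\ mine (t - (m%:R^-1)%:E) (N%:R / m%:R)%:E <= s%:E.
Proof.
move=> m0 t0; have mr : (0 < m%:R^-1 :> R)%R by rewrite invr_gt0 ltr0n.
elim: N => [|N /= [IH1 IH2]] /=.
  rewrite big_ord0 mul0r; split; last by rewrite ge_min lexx orbT.
  by rewrite le_min t0 lexx.
rewrite big_ord_recr/= -natr1 mulrDl mul1r.
set s := (\sum_(i < N) _)%R in IH1 IH2 *; set k := (N%:R / m%:R)%R in IH1 IH2 *.
clearbody s k.
move: IH1 IH2; rewrite !le_min !ge_min.
case: t t0 => [t| |]//= t0; rewrite ?ltry ?leey ?lte_fin -?EFinB ?lee_fin.
  move=> /andP[st sk]; case: (ltP (k + m%:R^-1)%R t) => kt.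
    by move=> /orP[h|h]; rewrite mulr1; split; lra.
  by move=> /orP[h|h]; rewrite mulr0 addr0; split; lra.
by rewrite mulr1 => sk ks; split; lra.
Qed.

Lemma layers_ge0 n t : (0 <= layers n t)%R.
Proof. by apply: sumr_ge0 => j _; apply: mulr_ge0; rewrite ?invr_ge0 ?ler0n. Qed.

Lemma layers_le n t : 0 <= t -> (layers n t)%:E <= t.
Proof.
by move=> t0; have [+ _] := layers_bounds (n.+1 ^ 2) (ltn0Sn n) t0; rewrite le_min => /andP[].
Qed.

Lemma layers_cvg t : 0 <= t -> (layers n t)%:E @[n --> \oo] --> t.
Proof.
move=> t0.
have ub n := layers_le n t0.
have lb n : mine (t - (n.+1%:R^-1)%:E) n.+1%:R%:E <= (layers n t)%:E.
  have [_ /=] := layers_bounds (n.+1 ^ 2) (ltn0Sn n) t0.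
  by rewrite natrX expr2 mulfK.
case: t t0 ub lb => [t| |]//= t0 ub lb.
  apply: (@squeeze_cvge _ _ _ _ (fun n => (t - n.+1%:R^-1)%:E) _ (cst t%:E)).
  - near=> n; rewrite ub andbT; apply: le_trans (lb n).
    rewrite -EFinB le_min lexx lee_fin/=.
    have tn : (t <= n%:R)%R by near: n; exact: nbhs_infty_ger.
    by rewrite (le_trans _ (le_trans tn _)) ?ler_nat// gerBl.
  - apply: cvg_EFin; first by near=> n.
    rewrite /= -[X in _ --> X]subr0; apply: cvgB; first exact: cvg_cst.
    exact: cvg_harmonic.
  - exact: cvg_cst.
apply/cvgeyPge => A; near=> n; apply: le_trans (lb n).
rewrite addye// le_min leey lee_fin/= (@le_trans _ _ n%:R)// ?ler_nat//.
by near: n; exact: nbhs_infty_ger.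
Unshelve. all: by end_near. Qed.

End Layers.

Section BorelFamilies.
Context (R : realType) (T : ptopologicalType).
Local Open Scope ereal_scope.
Notation B := (borelType T).

Lemma open_borel (U : set T) : open U -> measurable (U : set B).
Proof. by move=> oU; exact: sub_sigma_algebra. Qed.

Lemma closed_borel (C : set T) : closed C -> measurable (C : set B).
Proof.
by move=> cC; rewrite -[C]setCK; apply: measurableC; apply: open_borel; exact: closed_openC.
Qed.

Lemma lsc_borel (f : T -> \bar R) : lower_semicontinuous f ->
  measurable_fun [set: B] f.
Proof.
move=> /lower_semicontinuousP lf.
apply: (measurability _ (ErealGenOInfty.measurableE R)).
move=> _ [_ [a ->] <-]; rewrite setTI; apply: open_borel.
by rewrite preimage_itvoy; exact: lf.
Qed.

Lemma continuous_borel (f : T -> R) : continuous f -> measurable_fun [set: B] f.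
Proof.
move=> /continuousP cf; apply: (measurability _ (RGenOpens.measurableE R)).
move=> _ [_ [a [b ->] <-]]; rewrite setTI; apply: open_borel.
by apply: cf; exact: interval_open.
Qed.

Hypotheses (lcT : locally_compact [set: T]) (hT : hausdorff_space T)
  (scT : @second_countable T).

Lemma compact_borel (K : set T) : compact K -> measurable (K : set B).
Proof. by move=> /(compact_closed hT) /closed_borel. Qed.

Lemma open_increasing_compact (U : set T) : open U ->
  exists K : nat -> set T, [/\ forall n, compact (K n), nondecreasing_seq K
    & U = \bigcup_n K n].
Proof.
move=> oU; have [K cK UK] := open_sigma_compact R lcT hT scT oU.
exists (fun n => \big[setU/set0]_(i < n.+1) K i); split.
- by move=> n; elim/big_ind : _ => //; [exact: compact0|exact: compactU].
- by move=> m n mn; exact/subsetPset/subset_bigsetU.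
- by rewrite UK bigcup_bigsetU_bigcup.
Qed.

(** Continuity from below along a compact exhaustion of [U]; it serves every Borel measure,
    including those whose Radon property is still to be established. *)
Lemma measure_open_compact (mu : {measure set B -> \bar R}) (U : set T) (a : R) :
  open U -> a%:E < mu U -> exists K, [/\ compact K, K `<=` U & a%:E < mu K].
Proof.
move=> oU aU; have [K [cK ndK UK]] := open_increasing_compact oU.
have : mu (K n) @[n --> \oo] --> mu (\bigcup_n K n).
  apply: nondecreasing_cvg_mu => //; first by move=> n; exact: compact_borel.
  by rewrite -UK; exact: open_borel.
rewrite -UK => /ereal_cvg_exists_gt /(_ aU)[n aK].
by exists (K n); split => //; rewrite UK; exact: bigcup_sup.
Qed.

Variable X : topologicalType.
Implicit Type mu : X -> {measure set B -> \bar R}.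

(** The half of weak continuity, in the sense of the portmanteau theorem, that passes through sums
    and kernels. *)
Definition lsc_family mu :=
  forall V : set T, open V -> lower_semicontinuous (fun x => mu x V).

(** A compact part of the slice at [x] already has mass above [a]; the tube lemma surrounds it by
    one open [V] contained in all nearby slices, which reduces the claim to the fixed set [V]. *)
Lemma lsc_slice mu (O : set (X * T)) : lsc_family mu -> open O ->
  lower_semicontinuous (fun x => mu x [set y | O (x, y)]).
Proof.
move=> lmu oO x a aO.
have oS z : open [set y | O (z, y)].
  by have /continuousP := @pairl_continuous X T z; apply.
have [K [cK KO aK]] := measure_open_compact (oS x) aO.
have [N [V [Nx oV KV NVO]]] := compact_tube cK oO KO.
have aV : a%:E < mu x V.
  by apply: lt_le_trans aK _; apply: le_measure; rewrite ?inE//;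
    [exact: compact_borel|exact: open_borel].
have [M Mx Ma] := lmu _ oV _ _ aV.
exists (N `&` M); first exact: filterI.
move=> z [Nz /Ma aVz]; apply: lt_le_trans aVz _.
apply: le_measure; rewrite ?inE//; [exact: open_borel|exact: open_borel|].
by move=> y Vy; exact: NVO.
Qed.

(* Layer-cake approximation by sums of measures of open slices, then Fatou. *)
Lemma lsc_integral mu (h : X * T -> \bar R) : lsc_family mu ->
  (forall p, 0 <= h p) -> lower_semicontinuous h ->
  lower_semicontinuous (fun x => \int[mu x]_y h (x, y)).
Proof.
move=> lmu h0 lh.
have lhx x : lower_semicontinuous (fun y => h (x, y)).
  by apply: (lsc_comp (c := fun y => (x, y))) lh => y; exact: pairl_continuous.
pose O n j : set (X * T) := [set p | (j.+1%:R / n.+1%:R)%:E < h p].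
have oO n j : open (O n j) by move/lower_semicontinuousP : lh; exact.
have oOx n j x : open [set y | O n j (x, y)].
  by move/lower_semicontinuousP : (lhx x); exact.
have layersE n x y : (layers n (h (x, y)))%:E =
    \sum_(j < n.+1 ^ 2) (n.+1%:R^-1)%:E * (\1_[set y | O n j (x, y)] y)%:E.
  rewrite -sumEFin; apply: eq_bigr => j _; rewrite -EFinM; congr (_ * _)%:E.
  rewrite indicE; congr (_ %:R); congr nat_of_bool.
  by apply/idP/idP; [rewrite inE|rewrite inE].
have mlay n x : measurable_fun [set: B] (fun y => (layers n (h (x, y)))%:E).
  under eq_fun do rewrite layersE; apply: emeasurable_sum => j.
  apply: measurable_funeM; apply/measurable_EFinP.
  by apply: measurable_indic; exact: open_borel.
have lint n : lower_semicontinuous (fun x => \int[mu x]_y (layers n (h (x, y)))%:E).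
  rewrite [X in lower_semicontinuous X](_ : _ = fun x =>
      \sum_(j < n.+1 ^ 2) (n.+1%:R^-1)%:E * mu x [set y | O n j (x, y)]).
    apply: lsc_sum => [j x|j]; first by rewrite mule_ge0// lee_fin invr_ge0.
    by apply: lscZ; [rewrite invr_gt0 ltr0n|exact: lsc_slice].
  apply/funext => x; under eq_integral do rewrite layersE.
  rewrite ge0_integral_sum//; last first.
    move=> j; apply: measurable_funeM; apply/measurable_EFinP.
    by apply: measurable_indic; exact: open_borel.
  apply: eq_bigr => j _; rewrite ge0_integralZl//.
  - by rewrite integral_indic ?setIT//; exact: open_borel.
  - by apply/measurable_EFinP; apply: measurable_indic; exact: open_borel.
move=> x a ax.
have /= : a%:E < limn_einf (fun n => \int[mu x]_y (layers n (h (x, y)))%:E).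
  apply: lt_le_trans ax _.
  apply: le_trans (fatou _ measurableT _ _) => //; last first.
    by move=> n y _; rewrite lee_fin layers_ge0.
  rewrite le_eqVlt; apply/orP; left; apply/eqP; apply: eq_integral => y _.
  by have [-> _] := cvg_limn_einf_sup (layers_cvg (h0 (x, y))).
rewrite limn_einf_lim => alim.
have [n an] : exists n, a%:E < \int[mu x]_y (layers n (h (x, y)))%:E.
  have /ereal_cvg_exists_gt /(_ alim)[n an] :=
    @is_cvg_einfs R (fun n => \int[mu x]_y (layers n (h (x, y)))%:E).
  exists n; apply: lt_le_trans an _; apply: ereal_inf_lbound.
  by exists n => //=.
have [V Vx Vn] := lint n _ _ an; exists V => // z /Vn anz.
apply: lt_le_trans anz _; apply: ge0_le_integral => //.
- by move=> y _; rewrite lee_fin layers_ge0.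
- exact: lsc_borel.
- by move=> y _; exact: layers_le.
Qed.

End BorelFamilies.

Lemma setD_bigcupr T (A : set T) (F : nat -> set T) :
  A `\` \bigcup_n F n = \bigcap_n (A `\` F n).
Proof.
apply/seteqP; split => [x [Ax nF] n _|x AF]; first by split => // Fx; apply: nF; exists n.
by split; [have [] := AF 0%N I|move=> [n _ Fx]; have [] := AF n I].
Qed.

(** * Borel sets of a product of second countable spaces *)

Section SecondCountableBorel.
Context (T : ptopologicalType).
Hypothesis scT : @second_countable T.
Notation B := (borelType T).

Lemma open_prod_borel (O : set (T * T)) : open O ->
  measurable (O : set (B * B)%type).
Proof.
move=> oO; have [b cb [bo bB]] := scT.
pose D : set (set T * set T) := [set p | b p.1 /\ b p.2 /\ p.1 `*` p.2 `<=` O].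
have cD : countable D.
  apply: (@sub_countable _ _ _ (b `*` b)); last exact: countableX.
  by apply: subset_card_le => -[p q] [/= ? []].
have -> : O = \bigcup_(p in D) (p.1 `*` p.2).
  apply/seteqP; split => [[x y] Oxy|z [p [_ [_ pO]] pz]]; last exact: pO.
  have [[U V] /= [Ux Vy] UVO] : nbhs (x, y) O by exact: open_nbhs_nbhs.
  have [u [bu ux] uU] := bB _ _ Ux; have [v [bv vy] vV] := bB _ _ Vy.
  exists (u, v) => //; split => //; split => //= -[s t] [/= us vt].
  by apply: UVO; split; [exact: uU|exact: vV].
have [D0|/set0P D0] := eqVneq D set0; first by rewrite D0 bigcup_set0.
have /pfcard_geP[De|[e]] := cD; first by move: D0; rewrite De => -[].
rewrite (_ : \bigcup_(p in D) _ = \bigcup_n ((e n).1 `*` (e n).2)).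
  apply: bigcupT_measurable => n.
  have [b1 [b2 _]] : D (e n) by apply: (@funS _ _ _ _ e).
  by apply: measurableX; apply: open_borel; exact: bo.
apply/seteqP; split => [x [p Dp px]|x [n _ px]].
  by have [n _ en] := @surj _ _ _ _ e p Dp; exists n => //=; rewrite en.
by exists (e n) => //; apply: (@funS _ _ _ _ e).
Qed.

(** The definitions speak of Borel functions on [G * G], whereas Tonelli and kernels work with the
    product sigma-algebra; second countability makes the two agree. *)
Lemma measurable_prod_borel d (Y : measurableType d) (f : T * T -> Y) :
  measurable_fun [set: borelType (T * T)%type] f <->
  measurable_fun [set: B * B] f.
Proof.
split=> mf _ A mA; have := mf measurableT A mA; rewrite !setTI.
  move: (f @^-1` A) => {}A {}mA.
  suff : <<s @open (T * T)%type >> `<=` @measurable _ (B * B)%type by exact.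
  apply: smallest_sub; first exact: sigma_algebra_measurable.
  by move=> O; exact: open_prod_borel.
have : measurable_fun [set: borelType (T * T)%type] (id : T * T -> B * B).
  have mcont (g : T * T -> T) : continuous g ->
      measurable_fun [set: borelType (T * T)%type] (g : _ -> B).
    move=> /continuousP cg.
    have h := @measurability _ _ (borelType (T * T)%type) B setT g (@open T) erefl.
    refine (h _) => _ [U oU <-].
    by rewrite setTI; apply: sub_sigma_algebra; exact: cg.
  by apply/measurable_fun_pairP; split; apply: mcont => p; [exact: cvg_fst|exact: cvg_snd].
by move=> mid /(mid measurableT); rewrite setTI.
Qed.

End SecondCountableBorel.

(** * Regularity of finite Borel measures *)

Section Regularity.
Context (R : realType) (T : ptopologicalType).
Local Open Scope ereal_scope.
Hypotheses (lcT : locally_compact [set: T]) (hT : hausdorff_space T)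
  (scT : @second_countable T).
Notation B := (borelType T).
Variable mu : {measure set B -> \bar R}.
Hypothesis muoo : mu setT < +oo.

Let fin A : measurable A -> mu A < +oo.
Proof.
by move=> mA; apply: le_lt_trans muoo; apply: le_measure; rewrite ?inE.
Qed.

(** The sets squeezed between a closed and an open set up to small measure form a sigma-algebra,
    which contains the open sets because these are increasing unions of compact sets. *)
Lemma finite_borel_measure_regular (A : set B) (e : R) : measurable A -> (0 < e)%R ->
  exists U F : set T, [/\ open U, closed F, F `<=` A, A `<=` U & mu (U `\` F) < e%:E].
Proof.
move=> mA; move: e.
pose C := [set A : set B | forall e, (0 < e)%R ->
  exists U F : set T, [/\ open U, closed F, F `<=` A, A `<=` U & mu (U `\` F) < e%:E]].
suff /(_ A mA) : @measurable _ B `<=` C by [].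
have mUF (U F : set T) : open U -> closed F -> measurable (U `\` F : set B).
  by move=> /open_borel mU /closed_borel mF; exact: measurableD.
apply: smallest_sub; first split.
- move=> e e0; exists set0, set0; split => //; [exact: open0|exact: closed0|].
  by rewrite setD0 measure0 lte_fin.
- move=> {mA}A CA e e0; have [U [F [oU cF FA AU UF]]] := CA e e0.
  exists (~` F), (~` U); split; [exact: closed_openC|exact: open_closedC| | |].
  + by rewrite setTD; exact: subsetC.
  + by rewrite setTD; exact: subsetC.
  + by rewrite (_ : ~` F `\` ~` U = U `\` F)// setDE setCK setIC setDE.
- move=> {mA}A CA e e0.
  have e2 n : (0 < (e / 2) / (2 ^ n.+1)%:R :> R)%R.
    by rewrite !divr_gt0// ltr0n expn_gt0.
  have /choice[UF UFP] n : exists UF : set T * set T, [/\ open UF.1, closed UF.2,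
      UF.2 `<=` A n, A n `<=` UF.1 & mu (UF.1 `\` UF.2) < ((e / 2) / (2 ^ n.+1)%:R)%:E].
    by have [U [F ?]] := CA n _ (e2 n); exists (U, F).
  pose U := \bigcup_n (UF n).1; pose D := \bigcup_n (UF n).2.
  (* The union [D] of all the closed sets need not be closed. The finite unions [E n] are, and the
     strict bound on the mass of [U] outside [D] leaves room to stop at some [n]. *)
  pose E n := \big[setU/set0]_(i < n.+1) (UF i).2.
  have mF n : measurable ((UF n).2 : set B).
    by apply: closed_borel; have [] := UFP n.
  have oU : open U by apply: bigcup_open => n _; have [] := UFP n.
  have mU := open_borel oU.
  have mE n : measurable (E n : set B) by apply: bigsetU_measurable.
  have mD : measurable (D : set B) by exact: bigcupT_measurable.
  have UDe : mu (U `\` D) < e%:E.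
    apply: (@le_lt_trans _ _ (e / 2)%:E); last by rewrite lte_fin; lra.
    have mUFn n : measurable (((UF n).1 `\` (UF n).2) : set B).
      by have [? ? _ _ _] := UFP n; exact: mUF.
    apply: (@le_trans _ _ (\sum_(n <oo) mu ((UF n).1 `\` (UF n).2))).
      apply: measure_sigma_subadditive => //; first exact: measurableD.
      move=> x [[n _ Ux] nD]; exists n => //; split => // Fx.
      by apply: nD; exists n.
    apply: le_trans (epsilon_trick0 xpredT _); last by rewrite divr_ge0// ltW.
    by apply: lee_nneseries => // n *; apply: ltW; have [] := UFP n.
  have cvgE : mu (U `\` E n) @[n --> \oo] --> mu (U `\` D).
    have -> : U `\` D = \bigcap_n (U `\` E n).
      by rewrite /D -(bigcup_bigsetU_bigcup (fun n => (UF n).2)) setD_bigcupr.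
    apply: nonincreasing_cvg_mu.
    + by apply: fin; apply: measurableD.
    + by move=> n; apply: measurableD.
    + by apply: bigcapT_measurable => n; exact: measurableD.
    + move=> m n mn; apply/subsetPset; apply: setDS.
      exact: (subset_bigsetU (F := fun i => (UF i).2)).
  have [n En] : exists n, mu (U `\` E n) < e%:E.
    apply: contrapT => /forallNP h; move: UDe; apply/negP; rewrite -leNgt.
    by apply: (cvge_ge _ cvgE); apply: nearW => n; rewrite leNgt; exact/negP.
  exists U, (E n); split => //.
  + by apply: closed_bigsetU => i _; have [] := UFP i.
  + apply: (@subset_trans _ D).
      rewrite /D -(bigcup_bigsetU_bigcup (fun n => (UF n).2)).
      exact: (bigcup_sup (i := n)).
    by apply: subset_bigcup => i _; have [] := UFP i.
  + by apply: subset_bigcup => i _; have [] := UFP i.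
move=> V oV e e0.
have [K [cK ndK VK]] := open_increasing_compact R lcT hT scT oV.
have mK n : measurable (K n : set B) by exact: compact_borel.
have mV := open_borel oV.
have : mu (V `\` K n) @[n --> \oo] --> mu set0.
  have -> : set0 = \bigcap_n (V `\` K n).
    by rewrite -[LHS](setDv V) {2}VK setD_bigcupr.
  apply: nonincreasing_cvg_mu.
  + by apply: fin; apply: measurableD.
  + by move=> n; apply: measurableD.
  + by apply: bigcapT_measurable => n; exact: measurableD.
  + by move=> m n mn; apply/subsetPset; apply: setDS; exact/subsetPset/ndK.
rewrite measure0 => cvgK.
have [n Kn] : exists n, mu (V `\` K n) < e%:E.
  apply: contrapT => /forallNP h.
  have : e%:E <= 0.
    by apply: (cvge_ge _ cvgK); apply: nearW => n; rewrite leNgt; exact/negP.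
  by rewrite lee_fin leNgt e0.
exists V, (K n); split => //; first exact: compact_closed.
by rewrite VK; exact: bigcup_sup.
Qed.

Lemma finite_borel_measure_radon : radon mu.
Proof.
split.
- by move=> K cK; apply: fin; exact: compact_borel.
- move=> A mA; apply/eqP; rewrite eq_le; apply/andP; split.
    apply: le_ereal_inf_tmp => _ [U [oU AU] <-].
    by apply: le_measure; rewrite ?inE//; exact: open_borel.
  apply/lee_addgt0Pr => e e0.
  have [U [F [oU cF FA AU UFe]]] := finite_borel_measure_regular mA e0.
  apply: (@le_trans _ _ (mu U)); first by apply: ereal_inf_lbound; exists U.
  have mU := open_borel oU; have mF := closed_borel cF.
  rewrite -(setDUK AU) (le_trans (measureU2 _ _ _))//; first exact: measurableD.
  rewrite leeD2l// (le_trans _ (ltW UFe))//.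
  by apply: le_measure; rewrite ?inE; [exact: measurableD|exact: measurableD|exact: setDS].
- move=> U oU; apply/eqP; rewrite eq_le; apply/andP; split; last first.
    apply: ge_ereal_sup => _ [K [cK KU] <-].
    by apply: le_measure; rewrite ?inE//; [exact: compact_borel|exact: open_borel].
  have finU : mu U \is a fin_num.
    by rewrite ge0_fin_numE//; apply: fin; exact: open_borel.
  apply/lee_subgt0Pr => e e0.
  have eU : ((fine (mu U) - e)%:E < mu U)%E.
    by rewrite EFinB fineK// lteBlDr// lteDl// lte_fin.
  have [K [cK KU aK]] := measure_open_compact lcT hT scT oU eU.
  rewrite EFinB fineK// in aK; apply: (le_trans (ltW aK)).
  by apply: ereal_sup_ubound; exists K.
Qed.

End Regularity.

(** * Markov kernels *)

Section Kernels.
Context d (T : measurableType d) (R : realType).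
Local Open Scope ereal_scope.
Implicit Types (mu nu : probability T R) (f : T -> \bar R).

Definition measurable_family d' (X : measurableType d')
    (k : X -> probability T R) : Prop :=
  forall A, measurable A -> measurable_fun [set: X] (fun x => k x A).

(** Packages a measure of mass one as a [probability]; the Dirac mass is only the default of
    [mnormalize] for a degenerate total mass. *)
Lemma probability_of_measure (m : {measure set T -> \bar R}) : m setT = 1 ->
  exists nu, forall A, nu A = m A.
Proof.
move=> m1; exists (mnormalize m (\d_point)%R) => A.
transitivity (m A * (fine (m setT))^-1%:E); last by rewrite m1/= invr1 mule1.
rewrite [LHS]/=/mnormalize ifF// m1 onee_eq0//.
Qed.

Lemma probability_bind mu (k : T -> probability T R) : measurable_family k ->
  exists nu, forall f, (forall x, 0 <= f x) -> measurable_fun setT f ->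
    \int[nu]_x f x = \int[mu]_x \int[k x]_y f y.
Proof.
move=> mk.
pose k' : T -> giry T R := fun x => k x.
have mk' : measurable_fun setT k' by exact: measurable_giry_codensity.
pose m : giry T R := giry_bind (mu : giry T R) mk'.
have mE f : (forall x, 0 <= f x) -> measurable_fun setT f ->
    \int[m]_x f x = \int[mu]_x \int[k x]_y f y.
  by move=> f0 mf; exact: (giry_int_bind (mu : giry T R) mk').
have m1 : m setT = 1.
  rewrite -[LHS]mul1e -integral_cst// mE//.
  transitivity (\int[mu]_x cst 1 x).
    by apply: eq_integral => x _; rewrite integral_cst// mul1e; exact: probability_setT.
  by rewrite integral_cst// mul1e; exact: probability_setT.
have [nu nuE] := probability_of_measure m1.
exists nu => f f0 mf; rewrite -mE//.
by apply: eq_measure_integral => A mA _; rewrite -nuE.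
Qed.

End Kernels.

Section BoundedMeasurable.
Context d (T : measurableType d) (R : realType).
Implicit Types f g : T -> R.

Definition bmf f := measurable_fun setT f /\ exists M, forall x, `|f x| <= M.

Definition unit_fun f := measurable_fun setT f /\ forall x, 0 <= f x <= 1.

Lemma unit_fun_bmf f : unit_fun f -> bmf f.
Proof.
move=> [mf f01]; split => //; exists 1 => x.
by have /andP[f0 f1] := f01 x; rewrite ger0_norm.
Qed.

Lemma bmf_cst (c : R) : bmf (fun=> c).
Proof. by split; [exact: measurable_cst|exists `|c|]. Qed.

Lemma bmfD f g : bmf f -> bmf g -> bmf (fun x => f x + g x).
Proof.
move=> [mf [M fM]] [mg [N gN]]; split; first exact: measurable_funD.
by exists (M + N) => x; rewrite (le_trans (ler_normD _ _))// lerD.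
Qed.

Lemma bmfM f g : bmf f -> bmf g -> bmf (fun x => f x * g x).
Proof.
move=> [mf [M fM]] [mg [N gN]]; split; first exact: measurable_funM.
by exists (M * N) => x; rewrite normrM ler_pM.
Qed.

Lemma bmfZ (c : R) f : bmf f -> bmf (fun x => c * f x).
Proof. by move=> bf; apply: bmfM => //; exact: bmf_cst. Qed.

Lemma bmfB f g : bmf f -> bmf g -> bmf (fun x => f x - g x).
Proof.
move=> bf /(bmfZ (-1)) /(bmfD bf); congr bmf.
by apply/funext => x; rewrite mulN1r.
Qed.

Lemma bmf_norm f : bmf f -> bmf (fun x => `|f x|).
Proof.
move=> [mf [M fM]]; split; first exact: measurableT_comp.
by exists M => x; rewrite normr_id.
Qed.

Variable mu : {measure set T -> \bar R}.
Hypothesis muoo : (mu setT < +oo)%E.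

Lemma bmf_integrable f : bmf f -> mu.-integrable setT (EFin \o f).
Proof.
move=> [mf [M fM]]; apply: measurable_bounded_integrable => //.
exists M; split; first exact: num_real.
by move=> N MN x _ /=; exact: le_trans (fM x) (ltW MN).
Qed.

Lemma bmf_RintE f : bmf f ->
  (\int[mu]_x f x)%:E = (\int[mu]_x (f x)%:E)%E.
Proof. by move=> bf; rewrite fineK//; apply: integrable_fin_num => //; exact: bmf_integrable. Qed.

Lemma bmf_RintD f g : bmf f -> bmf g ->
  \int[mu]_x (f x + g x) = \int[mu]_x f x + \int[mu]_x g x.
Proof. by move=> /bmf_integrable fi /bmf_integrable gi; rewrite RintegralD. Qed.

Lemma bmf_RintB f g : bmf f -> bmf g ->
  \int[mu]_x (f x - g x) = \int[mu]_x f x - \int[mu]_x g x.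
Proof. by move=> /bmf_integrable fi /bmf_integrable gi; rewrite RintegralB. Qed.

Lemma bmf_RintZ (c : R) f : bmf f -> \int[mu]_x (c * f x) = c * \int[mu]_x f x.
Proof. by move=> /bmf_integrable fi; rewrite RintegralZl. Qed.

Lemma bmf_le_Rint f g : bmf f -> bmf g -> (forall x, f x <= g x) ->
  \int[mu]_x f x <= \int[mu]_x g x.
Proof. by move=> /bmf_integrable fi /bmf_integrable gi fg; apply: le_Rintegral. Qed.

Lemma Rint_cst (c : R) : \int[mu]_x c = c * fine (mu setT).
Proof. by rewrite Rintegral_cst. Qed.

End BoundedMeasurable.

(** Sum the restrictions of [lam] to the pieces [F n], the weights being chosen so that the total
    mass is at most 1. An [m]-almost everywhere statement then holds [lam]-almost everywhere. *)
Lemma sigma_finite_equivalent_finite d (T : measurableType d) (R : realType)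
    (lam : {measure set T -> \bar R}) : sigma_finite setT lam ->
  exists m : {measure set T -> \bar R},
    (m setT < +oo)%E /\ forall A, measurable A -> m A = 0%E -> lam A = 0%E.
Proof.
move=> [F FT Ffin].
have mF n : measurable (F n) by have [] := Ffin n.
have Foo n : (lam (F n) < +oo)%E by have [] := Ffin n.
have c0 n : 0 <= ((2 ^ n.+1)%:R * (1 + fine (lam (F n))))^-1 :> R.
  by rewrite invr_ge0 mulr_ge0// addr_ge0.
pose c n : R := ((2 ^ n.+1)%:R * (1 + fine (lam (F n))))^-1.
pose m_ n : {measure set T -> \bar R} := mscale (NngNum (c0 n)) (mrestr lam (mF n)).
pose m : {measure set T -> \bar R} := mseries m_ 0.
have mE A : m A = (\sum_(0 <= n <oo) (c n)%:E * lam (A `&` F n))%E by [].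
have c_gt0 n : 0 < c n.
  by rewrite invr_gt0 mulr_gt0 ?ltr0n ?expn_gt0// ltr_pwDl.
have cE n : (0 <= (c n)%:E)%E by rewrite lee_fin ltW.
exists m; split.
  apply: (@le_lt_trans _ _ 1%E); last by rewrite ltry.
  rewrite mE; apply: le_trans (epsilon_trick0 xpredT ler01).
  apply: lee_nneseries => [n *|n *]; first exact: mule_ge0.
  rewrite setTI -(@fineK _ (lam (F n))) ?ge0_fin_numE// -EFinM lee_fin.
  rewrite /c invfM -mulrA mul1r ler_piMr ?invr_ge0//.
  have l0 : 0 <= fine (lam (F n)) by rewrite fine_ge0.
  by rewrite ler_pdivrMl ?mulr1 ?lerDr ?ler01// ltr_pwDl.
move=> A mA mA0.
have FA0 n : lam (A `&` F n) = 0%E.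
  have h : ((c n)%:E * lam (A `&` F n) <= 0)%E.
    rewrite -[X in (_ <= X)%E]mA0 mE (@nneseriesD1 _ _ n)//; last by move=> *; exact: mule_ge0.
    by rewrite leeDl// nneseries_ge0// => *; exact: mule_ge0.
  by apply/eqP; rewrite -measure_le0; move: h; rewrite pmule_rle0 ?lte_fin.
have -> : A = \bigcup_n (A `&` F n) by rewrite -setI_bigcupr -FT setIT.
apply/eqP; rewrite -measure_le0.
apply: (@le_trans _ _ (\sum_(0 <= n <oo) lam (A `&` F n))%E).
  apply: measure_sigma_subadditive => //.
  - by move=> n; exact: measurableI.
  - by apply: bigcupT_measurable => n; exact: measurableI.
by rewrite eseries0// => n *; exact: FA0.
Qed.

Lemma cvg_abs_summable (R : realType) (u : nat -> R) :
  (\sum_(0 <= k <oo) `|(u k.+1 - u k)%:E| < +oo)%E -> cvgn u.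
Proof.
move=> uoo; have cu : cvgn (series (telescope u)).
  apply: normed_cvg; apply: nondecreasing_is_cvgn.
    by apply: nondecreasing_series => n _ _; exact: normr_ge0.
  exists (fine (\sum_(0 <= k <oo) `|(u k.+1 - u k)%:E|)%E) => _ [n _ <-].
  rewrite -lee_fin fineK; last by rewrite ge0_fin_numE// nneseries_ge0.
  rewrite /series/= -sumEFin; exact: (@nneseries_lim_ge _ _ xpredT).
have -> : u = fun n => series (telescope u) n + u 0%N.
  by apply/funext => n; rewrite telescopeK/= subrK.
by apply: is_cvgD => //; exact: is_cvg_cst.
Qed.

(** * Almost everywhere limits along decreasing convex sets *)

Section ConvexCompactness.
Context d (T : measurableType d) (R : realType).
Variables (m : {measure set T -> \bar R}) (C : nat -> set (T -> R)).
Hypotheses (moo : (m setT < +oo)%E)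
  (C_unit : forall n f, C n f -> unit_fun f)
  (C_decr : forall n p, (n <= p)%N -> C p `<=` C n)
  (C_mid : forall n f g, C n f -> C n g -> C n (fun x => (f x + g x) / 2))
  (C_neq0 : forall n, C n !=set0).

Let E (f : T -> R) := \int[m]_x (f x * f x).
Let M := fine (m setT).

Let E_bounds n f : C n f -> 0 <= E f <= M.
Proof.
move=> /C_unit uf; have bf := unit_fun_bmf uf; have [mf f01] := uf.
apply/andP; split; first by apply: Rintegral_ge0 => x _; rewrite -expr2 sqr_ge0.
rewrite -[leRHS]mul1r -Rint_cst//; apply: bmf_le_Rint => //.
- exact: bmfM.
- exact: bmf_cst.
- by move=> x; have /andP[f0 f1] := f01 x; rewrite mulr_ile1.
Qed.

(* Elements of almost minimal energy are close to each other by the parallelogram identity. *)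
Let energy_gap n f g (a e : R) : C n f -> C n g -> E f <= a + e -> E g <= a + e ->
  (forall h, C n h -> a - e <= E h) ->
  \int[m]_x ((f x - g x) * (f x - g x)) <= 8 * e.
Proof.
move=> Cf Cg Efa Ega Emid.
have bf := unit_fun_bmf (C_unit Cf); have bg := unit_fun_bmf (C_unit Cg).
have := Emid _ (C_mid Cf Cg); rewrite /E.
have -> : \int[m]_x ((f x - g x) * (f x - g x)) =
    2 * E f + 2 * E g - 4 * \int[m]_x ((f x + g x) / 2 * ((f x + g x) / 2)).
  have bff := bmfM bf bf; have bgg := bmfM bg bg.
  have bh : bmf (fun x => (f x + g x) / 2).
    by have := bmfZ 2^-1 (bmfD bf bg); congr bmf; apply/funext => x; rewrite mulrC.
  have bhh := bmfM bh bh.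
  rewrite -!(bmf_RintZ moo)// -(bmf_RintD moo); [|exact: bmfZ|exact: bmfZ].
  rewrite -(bmf_RintB moo); [|by apply: bmfD; exact: bmfZ|exact: bmfZ].
  by apply: eq_Rintegral => x _; field.
by move: Efa Ega; rewrite /E; lra.
Qed.

(** A substitute for weak compactness. The infima of the energy on the [C n] increase to a finite
    [a], so near-minimisers taken from different [C n] have midpoints of energy at least almost [a];
    hence they are close in L^2, and a geometric rate yields almost everywhere convergence. *)
Lemma convex_ae_cvg : exists h : nat -> T -> R, exists h' : T -> R,
  [/\ forall k, C k (h k), unit_fun h'
    & {ae m, forall x, h k x @[k --> \oo] --> h' x}].
Proof.
pose I n := inf [set E f | f in C n].
have I_inf n : has_inf [set E f | f in C n].
  split; first by have [f Cf] := C_neq0 n; exists (E f); exists f.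
  by exists 0 => _ [f Cf <-]; have /andP[] := E_bounds Cf.
have I_le n f : C n f -> I n <= E f.
  by move=> Cf; apply: ge_inf; [have [] := I_inf n|exists f].
have I_sup : has_sup (range I).
  split; first by exists (I 0%N); exists 0%N.
  exists M => _ [n _ <-]; have [f Cf] := C_neq0 n.
  by apply: le_trans (I_le _ _ Cf) _; have /andP[] := E_bounds Cf.
pose a := sup (range I).
have I_a n : I n <= a by apply: ub_le_sup; [have [] := I_sup|exists n].
(* The squared L^2 distance of consecutive terms will be at most [8 * e k], so powers of 4 make the
   distances themselves decay like powers of 2. *)
pose e k : R := (4 ^+ k)^-1.
have e0 k : 0 < e k by rewrite invr_gt0 exprn_gt0.
have /choice[h hP] k : exists f, exists2 n, (k <= n)%N &
    [/\ C n f, E f <= a + e k & a - e k <= I n].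
  have [_ [n _ <-] aI] := sup_adherent (e0 k) I_sup.
  have [n' kn' aI'] : exists2 n', (k <= n')%N & a - e k <= I n'.
    exists (maxn k n); first exact: leq_maxl.
    apply: (le_trans (ltW aI)); apply: lb_le_inf; first by have [] := I_inf (maxn k n).
    by move=> _ [f Cf <-]; apply: I_le; exact: (C_decr (leq_maxr k n)).
  have [_ [f Cf <-] Ef] := inf_adherent (e0 k) (I_inf n').
  exists f; exists n' => //; split => //; apply: (le_trans (ltW Ef)).
  by rewrite lerD2r; exact: I_a.
have Ch k : C k (h k) by have [n kn [Cn _ _]] := hP k; exact: (C_decr kn).
have bh k : bmf (h k) := unit_fun_bmf (C_unit (Ch k)).
have gap k : \int[m]_x ((h k.+1 x - h k x) * (h k.+1 x - h k x)) <= 8 * e k.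
  have [n kn [Cn En In]] := hP k; have [p kp [Cp Ep Ip]] := hP k.+1.
  have ee : e k.+1 <= e k.
    by rewrite /e lef_pV2 ?posrE ?exprn_gt0// exprS ler_peMl ?exprn_ge0// ler1n.
  (* The midpoint is only known to lie in the larger of the two sets. Its energy is still at least
     [a - e k], since both indices were chosen with infimum near [a]. *)
  apply: (@energy_gap (minn n p) _ _ a).
  - exact: (C_decr (geq_minr n p)).
  - exact: (C_decr (geq_minl n p)).
  - by lra.
  - by [].
  - move=> f /I_le; apply: le_trans; rewrite /minn; case: ifP => _ //.
    by lra.
have sumoo : (\sum_(0 <= k <oo) \int[m]_x `|(h k.+1 x - h k x)%:E| < +oo)%E.
  (* The 8 comes from [2 ^+ k / 2] times [8 * e k], and [M] from integrating the constant
     [(2 ^+ k.+1)^-1]. *)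
  apply: (@le_lt_trans _ _ (\sum_(0 <= k <oo) ((8 + M) / (2 ^ k.+1)%:R)%:E)%E).
    apply: lee_nneseries => [n *|k *]; first by apply: integral_ge0.
    have bd := bmfB (bh k.+1) (bh k).
    rewrite -(bmf_RintE moo (bmf_norm bd)) lee_fin.
    apply: (@le_trans _ _ (\int[m]_x (2 ^+ k / 2 *
      ((h k.+1 x - h k x) * (h k.+1 x - h k x)) + (2 ^+ k.+1)^-1))).
      apply: bmf_le_Rint => //; first exact: bmf_norm.
        by apply: bmfD; [apply: bmfZ; exact: bmfM|exact: bmf_cst].
      move=> x; set z := h k.+1 x - h k x.
      (* AM-GM: [2 |z| <= r z^2 + 1/r] for [r = 2^k] *)
      have r0 : (0 : R) < 2 ^+ k by rewrite exprn_gt0.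
      rewrite -[z * z]expr2 -real_normK ?num_real// [2 ^+ k.+1]exprS.
      rewrite -subr_ge0; set r := 2 ^+ k in r0 *.
      rewrite (_ : _ - _ = (r * `|z| - 1) ^+ 2 / (2 * r)).
        by rewrite divr_ge0 ?sqr_ge0// mulr_ge0// ltW.
      by field; rewrite gt_eqF.
    rewrite (bmf_RintD moo); [|by apply: bmfZ; exact: bmfM|exact: bmf_cst].
    rewrite (bmf_RintZ moo); last exact: bmfM.
    rewrite Rint_cst// -/M natrX mulrDl [_^-1 * M]mulrC lerD2r.
    have r0 : (0 : R) < 2 ^+ k by rewrite exprn_gt0.
    apply: (@le_trans _ _ (2 ^+ k / 2 * (8 * e k))).
      by rewrite ler_wpM2l// divr_ge0// ltW.
    rewrite /e (_ : 4 ^+ k = 2 ^+ k * 2 ^+ k); last first.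
      by rewrite -exprMn; congr (_ ^+ _); lra.
    rewrite exprS; set r := 2 ^+ k in r0 *.
    by rewrite le_eqVlt; apply/orP; left; apply/eqP; field; rewrite gt_eqF.
  have M0 : 0 <= 8 + M by rewrite addr_ge0// fine_ge0.
  apply: le_lt_trans (epsilon_trick0 xpredT M0) _.
  exact: ltry.
have mdiff k : measurable_fun setT (fun x => `|(h k.+1 x - h k x)%:E|)%E.
  by apply: measurableT_comp => //; apply/measurable_EFinP; have [] := bmfB (bh k.+1) (bh k).
have ae_sum : {ae m, forall x, (\sum_(0 <= k <oo) `|(h k.+1 x - h k x)%:E|)%E \is a fin_num}.
  have := @integrable_ae _ _ _ m setT measurableT
    (fun x => \sum_(0 <= k <oo) `|(h k.+1 x - h k x)%:E|)%E.
  have -> : m.-integrable setT (fun x => \sum_(0 <= k <oo) `|(h k.+1 x - h k x)%:E|)%E.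
    apply/integrableP; split; first exact: ge0_emeasurable_sum.
    under eq_integral do rewrite gee0_abs ?nneseries_ge0//.
    by rewrite integral_nneseries.
  by move=> /(_ isT); apply: filterS => x; apply.
pose l x := fine (limn_esup (fun k => (h k x)%:E)).
(* Clipping forces values in [0, 1] also where the sequence diverges, and changes nothing where it
   converges. *)
exists h, (fun x => Num.max 0 (Num.min 1 (l x))); split => //.
- split.
    apply: measurable_maxr; first exact: measurable_cst.
    apply: measurable_minr; first exact: measurable_cst.
    apply: measurableT_comp; first exact: fine_measurable.
    apply: measurable_fun_limn_esup => k.
    by apply/measurable_EFinP; have [] := bh k.
  move=> x; rewrite le_max lexx/= ge_max ler01/=.
  by rewrite ge_min lexx.
- apply: filterS ae_sum => x sx.
  have /cvg_abs_summable /cvg_ex[z hz] :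
      (\sum_(0 <= k <oo) `|(h k.+1 x - h k x)%:E| < +oo)%E.
    by move: sx; rewrite fin_numE => /andP[_ /eqP sx]; rewrite ltey; apply/eqP.
  have hk01 k : 0 <= h k x <= 1 by have [_] := C_unit (Ch k).
  have z0 : 0 <= z.
    by apply: (cvgr_to_ge hz); apply: nearW => k; have /andP[] := hk01 k.
  have z1 : z <= 1.
    by apply: (cvgr_to_le hz); apply: nearW => k; have /andP[] := hk01 k.
  suff -> : l x = z by rewrite (min_idPr z1) (max_idPr z0).
  have hzE : (h k x)%:E @[k --> \oo] --> z%:E by apply: cvg_EFin => //; exact: nearW.
  by rewrite /l; have [_ ->] := cvg_limn_einf_sup hzE.
Qed.

End ConvexCompactness.

(** * Markov operators, orbit sums and mixing *)

Section Markov.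
Context d (T : measurableType d) (R : realType).
Variable k : T -> probability T R.
Hypothesis mk : measurable_family k.
Implicit Types f g : T -> R.

Definition markov f (x : T) : R := \int[k x]_y f y.

Let koo x : (k x setT < +oo)%E.
Proof. by rewrite (le_lt_trans (probability_le1 _ _))// ltry. Qed.

Lemma markov_cst (c : R) x : markov (fun=> c) x = c.
Proof.
rewrite /markov Rint_cst [X in fine X](_ : _ = 1%E) ?mulr1//.
exact: probability_setT.
Qed.

Lemma markov_le f g x : bmf f -> bmf g -> (forall y, f y <= g y) ->
  markov f x <= markov g x.
Proof. by move=> bf bg; exact: (bmf_le_Rint (koo x)). Qed.

Lemma markovD f g x : bmf f -> bmf g ->
  markov (fun y => f y + g y) x = markov f x + markov g x.
Proof. by move=> bf bg; exact: (bmf_RintD (koo x)). Qed.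

Lemma markovZ (c : R) f x : bmf f -> markov (fun y => c * f y) x = c * markov f x.
Proof. by move=> bf; exact: (bmf_RintZ (koo x)). Qed.

Lemma markov_bmf f : bmf f -> bmf (markov f).
Proof.
move=> bf; have [mf [M fM]] := bf.
have fM0 y : 0 <= f y + M by have := fM y; rewrite ler_norml => /andP[h _]; rewrite -lerBlDr sub0r.
split.
  (* The shift by the bound [M] makes the integrand nonnegative for the measurability of kernel
     integrals; it comes off again because [markov] fixes constants. *)
  rewrite (_ : markov f = fun x => fine (\int[k x]_y (f y + M)%:E)%E - M).
    apply: measurable_funB; last exact: measurable_cst.
    apply: measurableT_comp; first exact: fine_measurable.
    apply: measurable_fun_integral_kernel => //.
      by apply/measurable_EFinP; exact: measurable_funD.
  apply/funext => x; rewrite -/(Rintegral (k x) setT (fun y => f y + M)).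
  by rewrite -/(markov (fun y => f y + M) x) markovD ?markov_cst ?addrK//; exact: bmf_cst.
exists M => x; rewrite ler_norml; apply/andP; split.
  rewrite -[leLHS](markov_cst _ x); apply: markov_le => //; first exact: bmf_cst.
  by move=> y; have := fM y; rewrite ler_norml => /andP[].
rewrite -[leRHS](markov_cst _ x); apply: markov_le => //; first exact: bmf_cst.
by move=> y; have := fM y; rewrite ler_norml => /andP[].
Qed.

Lemma markov_unit f : unit_fun f -> unit_fun (markov f).
Proof.
move=> uf; have bf := unit_fun_bmf uf; have [_ f01] := uf.
split; first by have [] := markov_bmf bf.
move=> x; apply/andP; split.
  rewrite -[leLHS](markov_cst _ x).
  
  by apply: (markov_le _ (bmf_cst _ _) bf) => y; have /andP[] := f01 y.
rewrite -[leRHS](markov_cst _ x); apply: (markov_le _ bf (bmf_cst _ _)) => y.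
by have /andP[] := f01 y.
Qed.

Lemma iter_markov_unit n f : unit_fun f -> unit_fun (iter n markov f).
Proof. by move=> uf; elim: n => //= n; exact: markov_unit. Qed.

Definition orbit_sum n f (x : T) : R := \sum_(i < n) iter i markov f x.

Lemma orbit_sumS n f : orbit_sum n.+1 f = fun x => orbit_sum n f x + iter n markov f x.
Proof. by apply/funext => x; rewrite /orbit_sum big_ord_recr. Qed.

Lemma orbit_sum0 f : orbit_sum 0 f = fun=> 0.
Proof. by apply/funext => x; rewrite /orbit_sum big_ord0. Qed.

Lemma orbit_sumD n m f :
  orbit_sum (n + m) f = fun x => orbit_sum n f x + orbit_sum m (iter n markov f) x.
Proof.
apply/funext => x; rewrite /orbit_sum big_split_ord/=; congr (_ + _).
by apply: eq_bigr => i _; rewrite addnC iterD.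
Qed.

Lemma orbit_sum_bmf n f : unit_fun f -> bmf (orbit_sum n f).
Proof.
move=> uf; elim: n => [|n IH]; first by rewrite orbit_sum0; exact: bmf_cst.
by rewrite orbit_sumS; apply: bmfD => //; apply: unit_fun_bmf; exact: iter_markov_unit.
Qed.

Lemma orbit_sum_bounds n f x : unit_fun f -> 0 <= orbit_sum n f x <= n%:R.
Proof.
move=> uf; elim: n => [|n IH]; first by rewrite orbit_sum0 lexx.
rewrite orbit_sumS -natr1; have [_ /(_ x)] := iter_markov_unit n uf.
by move: IH => /andP[? ?] /andP[? ?]; rewrite addr_ge0// lerD.
Qed.

(** The sum telescopes. The difference of the two end terms is at most 1 in absolute value whatever
    [n] is, so division by [n] gives an almost harmonic function. *)
Lemma markov_orbit_sum n f x : unit_fun f ->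
  markov (orbit_sum n f) x = orbit_sum n f x + iter n markov f x - f x.
Proof.
move=> uf; elim: n => [|n IH] /=; first by rewrite orbit_sum0 markov_cst add0r subrr.
rewrite orbit_sumS markovD//; last by apply: unit_fun_bmf; exact: iter_markov_unit.
  by rewrite IH; lra.
exact: orbit_sum_bmf.
Qed.

(** Replacing [f] by [1 - f] exchanges [x] and [y], so the one-sided bound controls both signs. The
    sums are not normalised, which makes [c] additive in [n]; the outer [markov] shifts them to the
    powers 1 to [n]. *)
Definition mixed n (c : R) x y := forall f, unit_fun f ->
  markov (orbit_sum n f) x <= markov (orbit_sum n f) y + c.

Lemma mixed_trivial n x y : mixed n n%:R x y.
Proof.
move=> f uf; have bA := orbit_sum_bmf n uf.
apply: (@le_trans _ _ n%:R).
  rewrite -[leRHS](markov_cst _ x); apply: (markov_le _ bA (bmf_cst _ _)) => z.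
  by have /andP[] := orbit_sum_bounds n z uf.
rewrite lerDr -(markov_cst 0 y); apply: (markov_le _ (bmf_cst _ _) bA) => z.
by have /andP[] := orbit_sum_bounds n z uf.
Qed.

(** The last [m] terms form an orbit sum of [iter n markov f], again a unit function; this is why
    [mixed] quantifies over all of them. *)
Lemma mixedD n m c e x y : mixed n c x y -> mixed m e x y -> mixed (n + m) (c + e) x y.
Proof.
move=> mn mm f uf; have un := iter_markov_unit n uf.
rewrite orbit_sumD !markovD; [|exact: orbit_sum_bmf..].
by have := mn _ uf; have := mm _ un; lra.
Qed.

Lemma mixed_mono n c e x y : c <= e -> mixed n c x y -> mixed n e x y.
Proof. by move=> ce mn f /mn; lra. Qed.

(** Cut [n] into blocks of length [m], each costing [m%:R * c]; the incomplete block is paid by the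
    trivial bound, at most [m]. One good length thus controls every large one at nearly the same
    rate. *)
Lemma mixed_large n m (c : R) x y : (0 < m)%N -> 0 <= c -> mixed m (m%:R * c) x y ->
  mixed n (n%:R * c + m%:R) x y.
Proof.
move=> m0 c0 mm; have [p] := ubnP n; elim: p n => // p IH n np.
have [nm|mn] := leqP n m.
  apply: mixed_mono (mixed_trivial n x y).
  by rewrite -[leLHS]add0r lerD ?ler_nat// mulr_ge0.
have := mixedD mm (IH (n - m)%N _).
rewrite subnKC; last exact: ltnW.
move=> h; apply: mixed_mono (h _); last first.
  rewrite -ltnS; apply: (leq_trans _ np); rewrite ltnS ltn_subrL m0.
  exact: leq_ltn_trans mn.
rewrite natrB; last exact: ltnW.
by lra.
Qed.

End Markov.

(** * From constant harmonic functions to mixing of two points *)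

Section MeanErgodic.
Context d (T : measurableType d) (R : realType).
Variable k : T -> probability T R.
Hypothesis mk : measurable_family k.
Variables (lam : {measure set T -> \bar R}) (F : set T).
Hypotheses (lam_sfin : sigma_finite setT lam) (mF : measurable F)
  (lamF : lam (~` F) = 0%E)
  (k_dom : forall z, F z -> forall A, measurable A -> lam A = 0%E -> k z A = 0%E)
  (lam_liouville : forall h, unit_fun h -> {ae lam, forall z, markov k h z = h z} ->
     exists c, {ae lam, forall z, h z = c}).

Let koo x : (k x setT < +oo)%E.
Proof. by rewrite (le_lt_trans (probability_le1 _ _))// ltry. Qed.

Let markov_cvg (h : nat -> T -> R) h' z : (forall n, unit_fun (h n)) -> unit_fun h' ->
  {ae k z, forall x, h n x @[n --> \oo] --> h' x} ->
  markov k (h n) z @[n --> \oo] --> markov k h' z.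
Proof.
move=> uh uh' hae; apply: fine_cvg; rewrite (bmf_RintE (koo z)); last exact: unit_fun_bmf.
have [||||| _ _] := @dominated_convergence _ _ _ (k z) setT measurableT
  (fun n x => (h n x)%:E) (fun x => (h' x)%:E) (cst 1%E).
- by move=> n; apply/measurable_EFinP; have [] := uh n.
- by apply/measurable_EFinP; have [] := uh'.
- by apply: filterS hae => x hx _; apply: cvg_EFin => //; exact: nearW.
- exact: (bmf_integrable (koo z) (bmf_cst _ 1)).
- apply: aeW => x n _; have [_ /(_ x)/andP[h0 h1]] := uh n.
  by rewrite /= lee_fin ger0_norm.
exact.
Qed.

Lemma liouville_mixed x y (e : R) : F x -> F y -> 0 < e ->
  exists N, forall n, (N <= n)%N -> mixed k n (n%:R * e) x y.
Proof.
move=> Fx Fy e0; apply: contrapT => /forallNP notmixed.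
pose C N := [set g : T -> R | [/\ unit_fun g,
  forall z, `|markov k g z - g z| <= N.+1%:R^-1 & markov k g y + e <= markov k g x]].
have [m [moo m_dom]] := sigma_finite_equivalent_finite lam_sfin.
have C_unit n f : C n f -> unit_fun f by case.
have C_decr n p : (n <= p)%N -> C p `<=` C n.
  move=> np f [uf fp fe]; split => // z; apply: le_trans (fp z) _.
  by rewrite lef_pV2 ?posrE ?ltr0n// ler_nat.
have C_mid n f g : C n f -> C n g -> C n (fun z => (f z + g z) / 2).
  move=> [uf fn fe] [ug gn ge]; have bf := unit_fun_bmf uf; have bg := unit_fun_bmf ug.
  have mE z : markov k (fun z => (f z + g z) / 2) z = (markov k f z + markov k g z) / 2.
    rewrite -(markovD _ _ bf bg) mulrC -markovZ; last exact: bmfD.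
    by congr markov; apply/funext => w; rewrite mulrC.
  split.
  - split.
      apply: measurable_funM; last exact: measurable_cst.
      by apply: measurable_funD; [have [] := uf|have [] := ug].
    move=> z; have [_ /(_ z)] := uf; have [_ /(_ z)] := ug; lra.
  - move=> z; have := fn z; have := gn z; rewrite mE; move: (n.+1%:R^-1) => r.
    rewrite !ler_norml => /andP[? ?] /andP[? ?]; apply/andP; split; lra.
  - by rewrite !mE; lra.
have C_neq0 N : C N !=set0.
  (* Failure of mixing at some [n] above [N] supplies [f]; the witness is the mean of its orbit,
     which [markov k] moves by at most [1 / n]. *)
  have /existsNP[n /not_implyP[Nn /existsNP[f /not_implyP[uf /negP]]]] := notmixed N.+1.
  rewrite -ltNge => fe.
  have n0 : (0 : R) < n%:R by rewrite ltr0n (leq_trans _ Nn).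
  have bA := orbit_sum_bmf mk n uf.
  exists (fun z => n%:R^-1 * orbit_sum k n f z); split.
  - split; first by have [] := bmfZ n%:R^-1 bA.
    move=> z; have /andP[A0 An] := orbit_sum_bounds mk n z uf.
    by rewrite mulr_ge0 ?invr_ge0 ?(ltW n0)//= ler_pdivrMl// mulr1.
  - move=> z; rewrite markovZ// -mulrBr normrM gtr0_norm ?invr_gt0//.
    apply: (@le_trans _ _ (n%:R^-1 * 1)).
      rewrite ler_pM2l ?invr_gt0// markov_orbit_sum//.
      have [_ /(_ z)] := uf; have [_ /(_ z)] := iter_markov_unit mk n uf.
      by rewrite ler_norml; lra.
    by rewrite mulr1 lef_pV2 ?ler_nat// posrE ?n0// ltr0n.
  - rewrite !markovZ// -(@ler_pM2l _ n%:R)// mulrDr !mulrA !mulfV ?gt_eqF// !mul1r.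
    exact: ltW.
have [h [h' [Ch uh' hae]]] := convex_ae_cvg moo C_unit C_decr C_mid C_neq0.
have uh n : unit_fun (h n) by have [] := Ch n.
have lam_ae : {ae lam, forall z, h n z @[n --> \oo] --> h' z}.
  by have [A [mA A0 hA]] := hae; exists A; split => //; exact: m_dom.
(* Convergence [lam]-almost everywhere is also [k z]-almost everywhere, so dominated convergence
   gives the limit at every [z] in [F], not merely at almost every one. *)
have cvgk z : F z -> markov k (h n) z @[n --> \oo] --> markov k h' z.
  move=> Fz; apply: markov_cvg => //.
  by have [A [mA A0 hA]] := lam_ae; exists A; split => //; exact: k_dom.
have [c h'c] : exists c, {ae lam, forall z, h' z = c}.
  apply: lam_liouville => //.
  have FAE : {ae lam, forall z, F z}.
    by exists (~` F); split => //; exact: measurableC.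
  move: FAE lam_ae; apply: filterS2 => z Fz hz.
  have d0 : (markov k (h n) z - h n z) @[n --> \oo] --> (0 : R).
    apply: norm_cvg0; apply: (squeeze_cvgr _ (@cvg_cst _ _ _ _ _) (@cvg_harmonic R)).
    by apply: nearW => n; rewrite normr_ge0/=; have [_ /(_ z)] := Ch n.
  have d1 : (markov k (h n) z - h n z) @[n --> \oo] --> markov k h' z - h' z.
    by apply: cvgB => //; exact: cvgk.
  apply/eqP; rewrite -subr_eq0; apply/eqP; rewrite -(cvg_lim (@Rhausdorff R) d1).
  exact: (cvg_lim (@Rhausdorff R) d0).
(* Likewise, constancy of [h'] almost everywhere determines [markov k h'] at each point of [F], in
   particular at [x] and [y], where it contradicts the gap. *)
have kc z : F z -> markov k h' z = c.
  move=> Fz; rewrite -(markov_cst k c z); congr fine.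
  apply: ae_eq_integral => //.
  - by apply/measurable_EFinP; have [] := uh'.
  - by have [A [mA A0 hA]] := h'c; exists A; split => //;
      [exact: k_dom|move=> w /= hw; apply: hA => /= hwc; apply: hw => _; rewrite hwc].
have d2 : (markov k (h n) x - markov k (h n) y) @[n --> \oo] --> (0 : R).
  by rewrite -(subrr c) -{1}(kc x Fx) -(kc y Fy); apply: cvgB; exact: cvgk.
have : e <= 0.
  apply: (cvgr_to_ge d2); apply: nearW => n; have [_ _] := Ch n.
  by rewrite lerBrDl addrC.
by rewrite leNgt e0.
Qed.

End MeanErgodic.

(** * Continuous systems of measures *)

Section IndicatorBounds.
Context d (T : measurableType d) (R : realType) (mu : {measure set T -> \bar R}).
Local Open Scope ereal_scope.

Lemma integral_indicT (A : set T) : measurable A -> \int[mu]_y (\1_A y)%:E = mu A.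
Proof. by move=> mA; rewrite integral_indic// setIT. Qed.

Lemma measure_le_integral (A : set T) (f : T -> \bar R) : measurable A ->
  measurable_fun setT f -> (forall y, 0 <= f y) -> (forall y, A y -> 1 <= f y) ->
  mu A <= \int[mu]_y f y.
Proof.
move=> mA mf f0 fA; rewrite -integral_indicT//; apply: ge0_le_integral => //.
  by apply/measurable_EFinP; exact: measurable_indic.
move=> y _; rewrite indicE; have [|_] := boolP (y \in A); last exact: f0.
by rewrite inE => /fA.
Qed.

Lemma integral_le_measure (A : set T) (f : T -> \bar R) : measurable A ->
  measurable_fun setT f -> (forall y, 0 <= f y <= 1) -> (forall y, ~ A y -> f y = 0) ->
  \int[mu]_y f y <= mu A.
Proof.
move=> mA mf f01 fA; rewrite -integral_indicT//; apply: ge0_le_integral => //.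
- by move=> y _; have /andP[] := f01 y.
- by apply/measurable_EFinP; exact: measurable_indic.
move=> y _; rewrite indicE; have [_|yA] := boolP (y \in A).
  by have /andP[] := f01 y.
by rewrite fA// => Ay; move/negP: yA; apply; rewrite inE.
Qed.

End IndicatorBounds.

Section SystemsOfMeasures.
Context (R : realType) (G : ptopologicalType) (S : semigroupoid G).
Hypotheses (lcG : locally_compact [set: G]) (hG : hausdorff_space G)
  (scG : @second_countable G).
Notation B := (borelType G).

(** A compact part of [V] witnesses mass above [a]; a Urysohn function between it and [V] has an
    integral that varies continuously and bounds the mass of [V] from below. *)
Lemma continuous_system_lsc (lambda : G -> {measure set B -> \bar R}) (c : G -> G) :
  continuous c -> (forall g, units S (c g)) -> continuous_system S lambda ->
  lsc_family (fun g => lambda (c g)).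
Proof.
move=> cc uc [lamP lamC] V oV g a aV.
have [K [cK KV aK]] := measure_open_compact lcG hG scG oV aV.
have [f [cf f01 fK fV fc]] := compact_urysohn R lcG hG cK oV KV.
have mf : measurable_fun [set: B] (EFin \o f).
  by apply/measurable_EFinP; exact: continuous_borel.
have f0 y : (0 <= (EFin \o f) y)%E by rewrite lee_fin; have /andP[] := f01 y.
pose I z := \int[lambda (c z)]_y f y.
have IE z : (I z)%:E = (\int[lambda (c z)]_y (f y)%:E)%E.
  rewrite fineK// ge0_fin_numE; last by apply: integral_ge0 => y _; exact: f0.
  set W := closure _ in fc.
  have mW : measurable (W : set B) by apply: closed_borel; exact: closed_closure.
  apply: (@le_lt_trans _ _ (lambda (c z) W)).
    apply: integral_le_measure => // y yW; apply/eqP; rewrite eqe; apply/negP => /negP fy.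
    by apply: yW; exact: subset_closure.
  by have [_ _ _ [+ _ _]] := lamP _ (uc z); apply.
have Ic : {for g, continuous I}.
  have /subspace_continuousP /(_ (c g) (uc g)) h := lamC f cf fc.
  apply: (cvg_comp (c : G -> G) (fun x => \int[lambda x]_y f y) _ h) => A /= wA.
  (* Continuity of the system is only relative to [units S]; as [c] takes its values there, the
     preimage under [c] is a full neighbourhood. *)
  have cA : nbhs g (c @^-1` [set y | units S y -> A y]) := cc g _ wA.
  have cA' : nbhs g (c @^-1` A) by apply: filterS cA => z /= /(_ (uc z)).
  exact: cA'.
have aI : a < I g.
  rewrite -lte_fin IE; apply: (lt_le_trans aK).
  apply: measure_le_integral => //; first exact: compact_borel.
  by move=> y /fK /= ->.
exists [set z | a < I z]; first exact: cvgr_gt Ic _ aI.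
move=> z /=; rewrite -lte_fin IE => /lt_le_trans; apply.
apply: integral_le_measure => //; first exact: open_borel.
by move=> y /fV /= ->.
Qed.

(** Both [f + M] and [M - f] are nonnegative, so their integrals are lower semicontinuous; the total
    mass being constantly 1, removing [M] gives both semicontinuities of the integral of [f]. *)
Lemma lsc_family_continuous (mu : G -> probability B R) (f : G -> R) :
  lsc_family (fun g => mu g) -> continuous f -> (exists M, forall y, `|f y| <= M) ->
  continuous (fun g => \int[mu g]_y f y).
Proof.
move=> lmu cf [M fM].
have near_gt (h : G -> R) g a : continuous h -> (forall y, `|h y| <= M) ->
    a < \int[mu g]_y h y -> \forall z \near g, a < \int[mu z]_y h y.
  move=> ch hM ah.
  have bh : bmf (h : B -> R) by split; [exact: continuous_borel|exists M].
  have bhM : bmf (fun y : B => h y + M) by apply: bmfD => //; exact: bmf_cst.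
  have muoo z : (mu z setT < +oo)%E by rewrite (le_lt_trans (probability_le1 _ _))// ltry.
  have E z : (\int[mu z]_y (h y + M)%:E)%E = (\int[mu z]_y h y + M)%:E.
    transitivity ((\int[mu z]_y (h y + M))%:E); first by rewrite (bmf_RintE (muoo z) bhM).
    congr EFin; rewrite [LHS](bmf_RintD (muoo z) bh (bmf_cst _ M)) Rint_cst; congr (_ + _).
    rewrite [X in fine X](_ : _ = 1%E) ?mulr1//; exact: probability_setT.
  have l : lower_semicontinuous (fun z => \int[mu z]_y (h y + M)%:E)%E.
    apply: (@lsc_integral R G lcG hG scG G (fun g => mu g) (fun p => (h p.2 + M)%:E)) => //.
      by move=> p; rewrite lee_fin -lerBlDr sub0r; have := hM p.2; rewrite ler_norml => /andP[].
    move=> p b; rewrite lte_fin => bp.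
    exists [set q | b < h q.2 + M]; last by move=> q /=; rewrite lte_fin.
    have : continuous (fun q : G * G => h q.2 + M).
      move=> q; apply: cvgD; last exact: cvg_cst.
      by apply: (cvg_comp (snd : G * G -> G) h); [exact: cvg_snd|exact: ch].
    by move=> /(_ p) /cvgr_gt; exact.
  have [V Vg VE] : exists2 V, nbhs g V & forall z, V z ->
      ((a + M)%:E < \int[mu z]_y (h y + M)%:E)%E.
    by apply: l; rewrite E lte_fin ltrD2r.
  by apply: filterS Vg => z /VE; rewrite E lte_fin ltrD2r.
move=> g; apply/cvgrPdist_lt => e e0.
have bf : bmf (f : B -> R) by split; [exact: continuous_borel|exists M].
have cNf : continuous (fun y => - f y) by move=> y; apply: cvgN; exact: cf.
have NE z : \int[mu z]_y (- f y) = - \int[mu z]_y f y.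
  rewrite -mulN1r -bmf_RintZ//.
    by apply: eq_Rintegral => y _; rewrite mulN1r.
  by rewrite (le_lt_trans (probability_le1 _ _))// ltry.
have h1 : \forall z \near g, \int[mu g]_y f y - e < \int[mu z]_y f y.
  by apply: near_gt => //; rewrite ltrBlDr ltrDl.
have h2 : \forall z \near g, - (\int[mu g]_y f y) - e < \int[mu z]_y (- f y).
  apply: near_gt => //; first by move=> y; rewrite normrN.
  rewrite NE.
  by rewrite ltrBlDr ltrDl.
near=> z.
have : \int[mu g]_y f y - e < \int[mu z]_y f y by near: z.
have : - (\int[mu g]_y f y) - e < \int[mu z]_y (- f y) by near: z.
rewrite NE ltr_norml => ? ?; apply/andP; split; lra.
Unshelve. all: by end_near. Qed.

Lemma compact_support_bounded (f : G -> R) : continuous f ->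
  compact (closure [set y | f y != 0]) -> exists M, forall y, `|f y| <= M.
Proof.
move=> cf fc.
have : compact (f @` closure [set y | f y != 0]).
  by apply: continuous_compact => //; exact: continuous_subspaceT.
move=> /compact_bounded [M [_ hM]].
exists (`|M| + 1) => y; have [->|fy] := eqVneq (f y) 0.
  by rewrite normr0 addr_ge0.
apply: (hM (`|M| + 1)); first by rewrite (le_lt_trans (ler_norm M))// ltrDl.
by exists y => //; exact: subset_closure.
Qed.

Lemma lsc_family_continuous_system (mu : G -> probability B R) :
  lsc_family (fun g => mu g) -> (forall x, units S x -> mu x (~` fiber S x) = 0%E) ->
  continuous_system S mu.
Proof.
move=> lmu muF; split; last first.
  move=> f cf fc; apply: continuous_subspaceT.
  by apply: lsc_family_continuous => //; exact: compact_support_bounded.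
have muoo x : (mu x setT < +oo)%E by rewrite (le_lt_trans (probability_le1 _ _))// ltry.
move=> x ux; split; [exact: muF| | |].
- move=> mu0; have /eqP : 1%E = 0%E :> \bar R := etrans (esym (probability_setT (mu x))) mu0.
  by rewrite onee_eq0.
- by exists (fun=> setT); [rewrite bigcup_const//; exists 0%N|move=> n; split => //; exact: muoo].
- exact: (finite_borel_measure_radon lcG hG scG (muoo x)).
Qed.

(** Dynkin's theorem starting from the open sets; stability under complements comes from the total
    mass being 1. *)
Lemma lsc_family_measurable (mu : G -> probability B R) :
  lsc_family (fun g => mu g) -> measurable_family (mu : B -> probability B R).
Proof.
move=> lmu A mA; move: A mA.
apply: (@dynkin_induction _ B (@open G) (fun A => measurable_fun [set: B] (fun x => mu x A))) => //.
- by move=> U V; exact: openI.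
- rewrite (_ : (fun x => _) = cst 1%E); first exact: measurable_cst.
  by apply/funext => x; exact: probability_setT.
- by move=> U oU; apply: lsc_borel; exact: lmu.
- move=> A mA mmA; rewrite (_ : (fun x => _) = (fun x => 1 - mu x A)%E).
    by apply: emeasurable_funB => //; exact: measurable_cst.
  by apply/funext => x; exact: probability_setC.
- move=> F mF tF mmF; rewrite (_ : (fun x => _) = (fun x => \sum_(0 <= k <oo) mu x (F k))%E).
    by apply: ge0_emeasurable_sum => // n *; exact: mmF.
  by apply/funext => x; apply/esym/cvg_lim => //; exact: measure_sigma_additive.
Qed.

End SystemsOfMeasures.

(** * Powers of the translation kernel *)

Section Conull.
Context d (T : measurableType d) (R : realType) (mu : {measure set T -> \bar R}).
Local Open Scope ereal_scope.

Lemma eq_integral_conull (F : set T) (f g : T -> \bar R) : measurable F ->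
  mu (~` F) = 0 -> measurable_fun setT f -> measurable_fun setT g ->
  (forall x, 0 <= f x) -> (forall x, 0 <= g x) -> (forall x, F x -> f x = g x) ->
  \int[mu]_x f x = \int[mu]_x g x.
Proof.
move=> mF F0 mf mg f0 g0 fg; apply: ge0_ae_eq_integral => //.
exists (~` F); split => //; first exact: measurableC.
by move=> x /= nfg Fx; apply: nfg => _; exact: fg.
Qed.

Lemma measure_conull (F A : set T) : measurable F -> measurable A ->
  mu (~` F) = 0 -> mu (F `&` A) = mu A.
Proof.
move=> mF mA F0; rewrite -[in RHS](setIT A) -(setvU F) setIUr measureU; last first.
- by rewrite setIACA setICl setI0.
- exact: measurableI.
- by apply: measurableI => //; exact: measurableC.
rewrite [X in X + _](_ : _ = 0) ?add0e 1?setIC//.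
apply: subset_measure0 F0 => //; last exact: measurableC.
by apply: measurableI => //; exact: measurableC.
Qed.

End Conull.

Section Iterates.
Context d (T : measurableType d) (R : realType).
Variable k : T -> probability T R.
Hypothesis mk : measurable_family k.

(** [K n] is the power [n.+1] of [k]: the enumeration skips the zeroth power, whose Dirac masses are
    in general not absolutely continuous with respect to [lambda]. *)
Definition iterates (K : nat -> T -> probability T R) : Prop :=
  (forall x, K 0 x = k x) /\
  (forall n x f, (forall y, 0 <= f y)%E -> measurable_fun setT f ->
     \int[K n.+1 x]_y f y = \int[K n x]_y \int[k y]_z f z)%E.

Lemma exists_iterates : exists K, iterates K.
Proof.
have /choice[next nextP] mu := probability_bind mu mk.
by exists (fun n x => iter n next (k x)); split => // n x f f0 mf; exact: nextP.
Qed.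

Variable K : nat -> T -> probability T R.
Hypothesis KP : iterates K.

Lemma iteratesE n x A : measurable A -> K n.+1 x A = (\int[K n x]_y k y A)%E.
Proof.
move=> mA; have [_ KS] := KP.
rewrite -[LHS](integral_indicT (K n.+1 x) mA) KS//.
  by apply: eq_integral => y _; exact: integral_indicT.
by apply/measurable_EFinP; exact: measurable_indic.
Qed.

Lemma measurable_family_iterates n : measurable_family (K n).
Proof.
elim: n => [|n IH] A mA.
  by have [K0 _] := KP; rewrite (_ : (fun x => _) = fun x => k x A);
    [exact: mk|apply/funext => x; rewrite K0].
rewrite (_ : (fun x => _) = fun x => \int[K n x]_y k y A)%E.
  by apply: measurable_fun_integral_kernel => //; exact: mk.
by apply/funext => x; exact: iteratesE.
Qed.

Lemma iterates_markov n x f : unit_fun f ->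
  (\int[K n x]_y (f y)%:E)%E = (iter n.+1 (markov k) f x)%:E.
Proof.
have [K0 KS] := KP.
have kE g y : unit_fun g -> (\int[k y]_z (g z)%:E)%E = (markov k g y)%:E.
  move=> ug; rewrite [RHS]bmf_RintE//; last exact: unit_fun_bmf.
  by rewrite (le_lt_trans (probability_le1 _ _))// ltry.
elim: n f => [|n IH] f uf; first by rewrite K0 kE.
rewrite KS; first last.
- by apply/measurable_EFinP; have [] := uf.
- by move=> y; rewrite lee_fin; have [_ /(_ y)/andP[]] := uf.
under eq_integral do rewrite kE//.
by rewrite IH -?iterSr//; exact: markov_unit.
Qed.

End Iterates.

Section TranslationKernel.
Context (R : realType) (G : ptopologicalType) (S : semigroupoid G).
Hypothesis hS : locally_compact_semigroupoid S.
Notation B := (borelType G).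

Let ctsS : continuous (src S). Proof. by have [[]] := hS. Qed.
Let cttS : continuous (tgt S). Proof. by have [[]] := hS. Qed.
Let lcG : locally_compact [set: G]. Proof. by have [] := hS. Qed.
Let hG : hausdorff_space G. Proof. by have [] := hS. Qed.
Let scG : @second_countable G. Proof. by have [] := hS. Qed.

Lemma units_src g : units S (src S g).
Proof. by rewrite -range_src; exists g. Qed.

Lemma units_tgt g : units S (tgt S g).
Proof. by rewrite -range_tgt; exists g. Qed.

Lemma tgt_src g : tgt S (src S g) = src S g.
Proof. exact/tgt_unit/units_src. Qed.

Lemma fiber_closed x : closed (fiber S x).
Proof.
apply: (closed_comp (f := tgt S) (D := [set x])) => [y _|]; first exact: cttS.
exact: accessible_closed_set1 (hausdorff_accessible hG) x.
Qed.

Lemma fiber_borel x : measurable (fiber S x : set B).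
Proof. by apply: closed_borel; exact: fiber_closed. Qed.

(** [comp] is continuous only relative to composable pairs; an open [Q] of the full product stands
    in for the preimage of [W], so that results on open slices apply. *)
Lemma comp_open (W : set G) : open W -> exists2 Q : set (G * G), open Q &
  forall g e, src S g = tgt S e -> (Q (g, e) <-> W (comp S g e)).
Proof.
move=> oW; have [[_ _ /continuousP cc] _ _ _] := hS.
have /open_subspaceP[Q oQ QE] := cc W oW.
exists Q => // g e ge; have cge : composable S (g, e) := ge.
move/seteqP: QE => [h1 h2]; split => [Qge|Wge].
  by have [] := h1 (g, e) (conj Qge cge).
by have [] := h2 (g, e) (conj Wge cge).
Qed.

(** Off the fiber [comp] is arbitrary and could fail to be measurable; the constant default makes
    the map Borel, and [pi (src S g)] has no mass there. *)
Definition left_mul (g e : G) : G := if tgt S e == src S g then comp S g e else g.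

Lemma left_mulE g e : tgt S e = src S g -> left_mul g e = comp S g e.
Proof. by move=> h; rewrite /left_mul h eqxx. Qed.

Lemma measurable_left_mul g : measurable_fun [set: B] (left_mul g : B -> B).
Proof.
have h := @measurability _ _ B B setT (left_mul g) (@open G) erefl.
refine (h _) => _ [W oW <-]; rewrite setTI.
have [Q oQ QE] := comp_open oW.
have mQ : measurable ([set e | Q (g, e)] : set B).
  apply: open_borel; have /continuousP := @pairl_continuous G G g; exact.
have mF := fiber_borel (src S g).
rewrite (_ : _ @^-1` _ = (fiber S (src S g) `&` [set e | Q (g, e)]) `|`
  (~` fiber S (src S g) `&` [set e | W g])).
  apply: measurableU; apply: measurableI => //; first exact: measurableC.
  have [Wg|nWg] := pselect (W g).
    by rewrite (_ : [set _ | _] = setT)//; apply/seteqP; split.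
  by rewrite (_ : [set _ | _] = set0)//; apply/seteqP; split.
apply/seteqP; split => e /=; rewrite /left_mul; case: eqP => [te|te].
- by move=> We; left; split => //; exact/(QE _ _ (esym te)).
- by move=> Wg; right.
- by move=> [[_ /(QE _ _ (esym te))]|[]].
- by move=> [[]|[]].
Qed.

Variable pi : G -> probability B R.
Hypothesis pi_cs : continuous_system S pi.

Let pi_fiber g : pi (src S g) (~` fiber S (src S g)) = 0%E.
Proof. by have [+ _] := pi_cs => /(_ _ (units_src g))[]. Qed.

Definition translation_kernel (k : G -> probability B R) : Prop :=
  forall g f, (forall y, 0 <= f y)%E -> measurable_fun [set: B] f ->
    (\int[k g]_y f y = \int[pi (src S g)]_y f (left_mul g y))%E.

Lemma exists_translation_kernel : exists k, translation_kernel k.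
Proof.
have /choice[k kP] g : exists nu : probability B R, forall f : B -> \bar R,
    (forall y, 0 <= f y)%E -> measurable_fun setT f ->
    (\int[nu]_y f y = \int[pi (src S g)]_y f (left_mul g y))%E.
  pose m := giry_map (measurable_left_mul g) (pi (src S g) : giry B R).
  have m1 : m setT = 1%E by exact: (probability_setT (pi (src S g))).
  have [nu nuE] := probability_of_measure m1.
  exists nu => f f0 mf.
  transitivity (giry_int m f).
    by apply: eq_measure_integral => A mA _; rewrite -nuE.
  exact: giry_int_map.
by exists k.
Qed.

Variable k : G -> probability B R.
Hypothesis kP : translation_kernel k.

Lemma translation_kernelE g (A : set B) : measurable A ->
  k g A = translate S g (pi (src S g)) A.
Proof.
move=> mA; rewrite -[LHS](integral_indicT (k g) mA) kP//; last first.
  by apply/measurable_EFinP; exact: measurable_indic.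
have mLA : measurable (left_mul g @^-1` A : set B).
  by rewrite -[X in measurable X]setTI; exact: measurable_left_mul.
rewrite (_ : (fun y => _) = fun y => (\1_(left_mul g @^-1` A) y)%:E)//.
rewrite integral_indicT// /translate -(measure_conull (fiber_borel (src S g)) mLA (pi_fiber g)).
congr (pi _ _); apply/seteqP; split => e [/= te]; rewrite left_mulE//.
Qed.

Lemma translation_kernel_fiber g : k g (~` fiber S (tgt S g)) = 0%E.
Proof.
have mF := fiber_borel (tgt S g).
rewrite translation_kernelE; last exact: measurableC.
rewrite /translate (_ : _ `&` _ = set0) ?measure0//; apply/seteqP; split => // e [/= te].
by move=> h; apply: h; rewrite /fiber /= tgt_comp.
Qed.

Lemma translation_kernel_lsc : lsc_family (fun g => k g).
Proof.
move=> W oW; have [Q oQ QE] := comp_open oW.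
have lpi := continuous_system_lsc lcG hG scG ctsS units_src pi_cs.
have -> : (fun g => k g W) = fun g => pi (src S g) [set e | Q (g, e)].
  apply/funext => g; rewrite translation_kernelE; last exact: open_borel.
  rewrite /translate.
  have mQ : measurable ([set e | Q (g, e)] : set B).
    by apply: open_borel; have /continuousP := @pairl_continuous G G g; exact.
  rewrite -(measure_conull (fiber_borel (src S g)) mQ (pi_fiber g)).
  by congr (pi _ _); apply/seteqP; split => e [/= te] h; split => //; exact/(QE _ _ (esym te)).
exact: (lsc_slice lcG hG scG lpi oQ).
Qed.

Lemma translation_kernel_measurable : measurable_family (k : B -> probability B R).
Proof. exact: (lsc_family_measurable translation_kernel_lsc). Qed.

Definition pullback (g : G) (f : G -> \bar R) (e : G) : \bar R :=
  if tgt S e == src S g then f (comp S g e) else 0%E.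

Lemma pullback_ge0 g f e : (forall y, 0 <= f y)%E -> (0 <= pullback g f e)%E.
Proof. by move=> f0; rewrite /pullback; case: ifP. Qed.

Lemma measurable_pullback g f : measurable_fun [set: B] f ->
  measurable_fun [set: B] (pullback g f).
Proof.
move=> mf.
rewrite (_ : pullback g f = fun e => (f (left_mul g e) * (\1_(fiber S (src S g)) e)%:E)%E).
  apply: emeasurable_funM.
    exact: (measurableT_comp mf (measurable_left_mul g)).
  by apply/measurable_EFinP; apply: measurable_indic; exact: fiber_borel.
apply/funext => e; rewrite /pullback /left_mul indicE; case: eqP => te.
  by rewrite mem_set// mule1.
by rewrite memNset// mule0.
Qed.

(** Equivariance of the kernel is associativity, [(g e) y = g (e y)], valid on the fiber that
    carries [pi (src S e)]. *)
Lemma translation_kernel_comp g e f : tgt S e = src S g ->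
  (forall y, 0 <= f y)%E -> measurable_fun [set: B] f ->
  (\int[k (comp S g e)]_y f y = \int[k e]_y pullback g f y)%E.
Proof.
move=> te f0 mf; rewrite !kP//; [|by move=> y; exact: pullback_ge0|exact: measurable_pullback].
rewrite src_comp//.
apply: (eq_integral_conull (fiber_borel (src S e)) (pi_fiber e)).
- apply: (measurableT_comp mf); exact: measurable_left_mul.
- apply: (measurableT_comp (measurable_pullback g mf)); exact: measurable_left_mul.
- by move=> y; exact: f0.
- by move=> y; exact: pullback_ge0.
move=> y /= ty; rewrite (left_mulE ty) /pullback tgt_comp// te eqxx left_mulE ?src_comp//.
by rewrite Defs.compA.
Qed.

Variable K : nat -> G -> probability B R.
Hypothesis KP : iterates (k : B -> probability B R) K.

Let mk := translation_kernel_measurable.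

Lemma iterates_fiber n g : K n g (~` fiber S (tgt S g)) = 0%E.
Proof.
have mF : measurable (~` fiber S (tgt S g) : set B) by apply: measurableC; exact: fiber_borel.
elim: n => [|n IH]; first by have [-> _] := KP; exact: translation_kernel_fiber.
rewrite (iteratesE KP)// (eq_integral_conull (fiber_borel (tgt S g)) (g := cst 0%E))//.
- by rewrite integral0.
- exact: mk.
- by move=> x <-; exact: translation_kernel_fiber.
Qed.

Lemma iterates_lsc n : lsc_family (fun g => K n g).
Proof.
elim: n => [|n IH].
  by have [K0 _] := KP; rewrite (_ : (fun g => _) = fun g => k g :> {measure set B -> \bar R});
    [exact: translation_kernel_lsc|apply/funext => g; rewrite K0].
move=> W oW; rewrite (_ : (fun g => _) = fun g => \int[K n g]_y k y W)%E; last first.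
  by apply/funext => g; apply: (iteratesE KP); exact: open_borel.
apply: (lsc_integral lcG hG scG (h := fun p => k p.2 W) IH) => // p a.
move=> /(translation_kernel_lsc oW)[V Vp Va]; exists (snd @^-1` V); last by move=> q /= /Va.
by apply: (cvg_snd (F := nbhs p.1)).
Qed.

Lemma iterates_comp n g e f : tgt S e = src S g ->
  (forall y, 0 <= f y)%E -> measurable_fun [set: B] f ->
  (\int[K n (comp S g e)]_y f y = \int[K n e]_y pullback g f y)%E.
Proof.
move=> te; have [K0 KS] := KP.
elim: n f => [|n IH] f f0 mf; first by rewrite !K0 translation_kernel_comp.
have mP := measurable_pullback g mf.
have P0 y : (0 <= pullback g f y)%E by exact: pullback_ge0.
have mkf h : (forall y, 0 <= h y)%E -> measurable_fun [set: B] h ->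
    measurable_fun [set: B] (fun z => \int[k z]_y h y)%E.
  by move=> h0 mh; apply: measurable_fun_integral_kernel => //; exact: mk.
rewrite !KS// IH//; [|by move=> y; exact: integral_ge0|exact: mkf].
apply: (eq_integral_conull (fiber_borel (tgt S e)) (iterates_fiber n e)).
- by apply: measurable_pullback; exact: mkf.
- exact: mkf.
- by move=> y; apply: pullback_ge0 => z; exact: integral_ge0.
- by move=> y; exact: integral_ge0.
by move=> z tz; rewrite [LHS]/pullback tz te eqxx translation_kernel_comp ?tz.
Qed.

(** Equivariance at the unit [src S g], using that [g] composed with it is [g]. The Reiter defect
    thereby compares one kernel at two points of the same fiber. *)
Lemma iterates_translate n g (A : set B) : measurable A ->
  translate S g (K n (src S g)) A = K n g A.
Proof.
move=> mA; have mLA : measurable (left_mul g @^-1` A : set B).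
  by rewrite -[X in measurable X]setTI; exact: measurable_left_mul.
rewrite -[in RHS](comp_src S g) -[RHS](integral_indicT _ mA) iterates_comp ?tgt_src//; last first.
  by apply/measurable_EFinP; exact: measurable_indic.
have mFA : measurable (fiber S (src S g) `&` left_mul g @^-1` A : set B).
  by apply: measurableI => //; exact: fiber_borel.
rewrite /translate (_ : _ `&` _ = fiber S (src S g) `&` left_mul g @^-1` A); last first.
  by apply/seteqP; split => e [/= te]; rewrite left_mulE.
rewrite -[LHS](integral_indicT _ mFA); apply: eq_integral => e _.
rewrite /pullback indicE; case: eqP => te.
  rewrite indicE (_ : (e \in _) = (comp S g e \in A))//.
  by apply/idP/idP; rewrite !inE /= left_mulE// => -[].
by rewrite memNset// => -[].
Qed.

End TranslationKernel.

(** * Densities *)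

Section SigmaFiniteWrapper.
Context d (T : measurableType d) (R : realType) (mu : {measure set T -> \bar R})
  (mu_sfin : sigma_finite setT mu).

(* [sigma_finite_of] repackages a measure that is only propositionally sigma-finite,
   as Tonelli's theorem is stated for the bundled structure. *)
Definition sigma_finite_of of sigma_finite setT mu : set T -> \bar R := mu.

Local Notation nu := (sigma_finite_of mu_sfin).

Let nu0 : nu set0 = 0%E. Proof. exact: measure0. Qed.
Let nu_ge0 A : (0 <= nu A)%E. Proof. exact: measure_ge0. Qed.
Let nu_additive : semi_sigma_additive nu.
Proof. exact: measure_semi_sigma_additive. Qed.

HB.instance Definition _ := isMeasure.Build _ _ _ nu nu0 nu_ge0 nu_additive.

HB.instance Definition _ := Measure_isSigmaFinite.Build _ _ _ nu mu_sfin.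

End SigmaFiniteWrapper.

Lemma tonelli_probability d d' (T : measurableType d) (T' : measurableType d')
    (R : realType) (mu : probability T R) (nu : {measure set T' -> \bar R})
    (f : T * T' -> \bar R) : sigma_finite setT nu ->
  measurable_fun setT f -> (forall p, 0 <= f p)%E ->
  (\int[mu]_x \int[nu]_y f (x, y) = \int[nu]_y \int[mu]_x f (x, y))%E.
Proof.
move=> nu_sfin mf f0.
pose nu' : {sigma_finite_measure set T' -> \bar R} := sigma_finite_of nu_sfin.
exact: (@fubini_tonelli _ _ _ _ _ mu nu' f mf f0).
Qed.

Section FamilyKernel.
Context d d' (X : measurableType d) (Y : measurableType d') (R : realType)
  (k : X -> probability Y R) (mk : measurable_family k).

(** The measurability proof is an argument so that the kernel instances below can be attached to
    this constant. *)
Definition kernel_of_family of measurable_family k : X -> {measure set Y -> \bar R} :=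
  fun x => k x.

Local Notation l := (kernel_of_family mk).

Let measurable_l U : measurable U -> measurable_fun [set: X] (l ^~ U).
Proof. exact: mk. Qed.

HB.instance Definition _ := isKernel.Build _ _ X Y R l measurable_l.

Let l_uub : measure_fam_uub l.
Proof.
by exists 2 => x; rewrite (le_lt_trans (probability_le1 _ _))// lte_fin ltr1n.
Qed.

HB.instance Definition _ := Kernel_isFinite.Build _ _ X Y R l l_uub.

Lemma measurable_fun_integral_family (f : X * Y -> \bar R) :
  (forall p, 0 <= f p)%E -> measurable_fun setT f ->
  measurable_fun setT (fun x => \int[k x]_y f (x, y))%E.
Proof. by move=> f0 mf; exact: (measurable_fun_integral_finite_kernel f l). Qed.

End FamilyKernel.

Section Densities.
Context (R : realType) (G : ptopologicalType) (S : semigroupoid G).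
Hypothesis hS : locally_compact_semigroupoid S.
Notation B := (borelType G).
Local Open Scope ereal_scope.
Variables (lambda : G -> {measure set B -> \bar R}) (pi : G -> probability B R)
  (k : G -> probability B R) (K : nat -> G -> probability B R)
  (D : G * G -> \bar R).
Hypotheses (lambda_sfin : forall g, sigma_finite setT (lambda (tgt S g)))
  (pi_cs : continuous_system S pi) (kP : translation_kernel S pi k)
  (KP : iterates (k : B -> probability B R) K)
  (mD : measurable_fun [set: B * B] D) (DP : joint_RN_derivative S pi lambda D).

Let mk := translation_kernel_measurable hS pi_cs kP.

(** Only the last step of the walk needs a density: [D (z, p.2)] is averaged over the position [z]
    reached before that step. *)
Fixpoint density (n : nat) (p : G * G) : \bar R :=
  if n is n'.+1 then \int[K n' p.1]_z D (z, p.2) else D p.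

Let D_ge0 p : 0 <= D p.
Proof. by case: p => g e; have [_ + _] := DP g; apply. Qed.

Lemma density_ge0 n p : 0 <= density n p.
Proof. by case: n => [|n] //=; exact: integral_ge0. Qed.

Lemma measurable_density n : measurable_fun [set: B * B] (density n).
Proof.
case: n => [|n] //=.
have mK : measurable_family (fun p : B * B => K n p.1).
  move=> A mA; apply: (measurableT_comp (measurable_family_iterates mk KP n mA)).
  exact: measurable_fst.
apply: (measurable_fun_integral_family mK (f := fun q : (B * B) * B => D (q.2, q.1.2))) => //.
apply: (measurableT_comp mD); apply: measurable_fun_pair; first exact: measurable_snd.
by apply: measurableT_comp; [exact: measurable_snd|exact: measurable_fst].
Qed.

Lemma measurable_density_slice n g : measurable_fun [set: B] (fun e => density n (g, e)).
Proof. apply: (measurableT_comp (measurable_density n)).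
by apply: measurable_fun_pair; [exact: measurable_cst|exact: measurable_id]. Qed.

Lemma iterates_density n g (A : set B) : measurable A ->
  K n g A = \int[lambda (tgt S g)]_(e in A) density n (g, e).
Proof.
have [K0 _] := KP; move=> mA.
have kD h : k h A = \int[lambda (tgt S h)]_(e in A) D (h, e).
  by rewrite (translation_kernelE hS pi_cs kP)//; have [_ _ ->] := DP h.
case: n => [|n]; first by rewrite K0 kD.
rewrite (iteratesE KP)//.
pose f (p : B * B) := D p * (\1_A p.2)%:E.
have mf : measurable_fun [set: B * B] f.
  apply: emeasurable_funM => //; apply/measurable_EFinP.
  by apply: measurableT_comp; [exact: measurable_indic|exact: measurable_snd].
have f0 p : 0 <= f p by rewrite /f mule_ge0// lee_fin.
have int_in h (nu : {measure set B -> \bar R}) :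
    \int[nu]_(e in A) h e = \int[nu]_e (h e * (\1_A e)%:E) :> \bar R.
  by rewrite integral_mkcond epatch_indic.
(* The density of [k z] refers to [lambda (tgt S z)]. Since [K n g] lives on the fiber over
   [tgt S g], a single reference measure serves almost every [z], and Tonelli applies. *)
transitivity (\int[K n g]_z \int[lambda (tgt S g)]_e f (z, e)).
  have mfib := fiber_borel hS (tgt S g).
  have Kfib : K n g (~` fiber S (tgt S g)) = 0%E by exact: (iterates_fiber hS pi_cs kP KP).
  apply: (eq_integral_conull mfib Kfib).
  - exact: mk.
  - apply: (@measurable_fun_fubini_tonelli_F _ _ _ _ _ (sigma_finite_of (lambda_sfin g)) f mf f0).
  - by [].
  - by move=> z; exact: integral_ge0.
  - by move=> z tz; rewrite kD tz int_in.
rewrite (tonelli_probability _ (lambda_sfin g) mf f0) int_in.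
apply: eq_integral => e _; rewrite /f /=.
rewrite (ge0_integralZr _ measurableT) ?lee_fin//.
apply: (measurableT_comp mD).
by apply: measurable_fun_pair; [exact: measurable_id|exact: measurable_cst].
Qed.

Lemma iterates_dominated n g (A : set B) : measurable A -> lambda (tgt S g) A = 0 ->
  K n g A = 0.
Proof.
move=> mA A0; rewrite iterates_density//; apply: null_set_integral => //.
by apply: measurable_funTS; exact: measurable_density_slice.
Qed.

End Densities.

Section IntegralDensity.
Context d (T : measurableType d) (R : realType).
Local Open Scope ereal_scope.
Variables (mu nu : {measure set T -> \bar R}) (w : T -> \bar R).
Hypotheses (w0 : forall x, 0 <= w x) (mw : measurable_fun setT w)
  (nuE : forall A, measurable A -> nu A = \int[mu]_(x in A) w x).

Import HBNNSimple.

Let integral_density_nnsfun (g : {nnsfun T >-> R}) :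
  \int[nu]_x (g x)%:E = \int[mu]_x ((g x)%:E * w x).
Proof.
have mr r : measurable (g @^-1` [set r]) by [].
have mI r : measurable_fun setT (fun x => (\1_(g @^-1` [set r]) x)%:E : \bar R).
  by apply/measurable_EFinP; exact: measurable_indic.
rewrite integralT_nnsfun sintegralE.
transitivity (\sum_(r \in range g) \int[mu]_x ((r * \1_(g @^-1` [set r]) x)%:E * w x)).
  apply: eq_fsbigr => r; rewrite inE => -[y _ <-].
  have gy0 : 0 <= (g y)%:E by rewrite lee_fin.
  rewrite nuE// [X in _ * X]integral_mkcond -ge0_integralZl//; last 2 first.
  - by apply/(measurable_restrictT _ _).1 => //; exact: measurable_funTS.
  - by move=> x _; apply: erestrict_ge0 => z _; exact: w0.
  apply: eq_integral => x _; rewrite epatch_indic/= EFinM -muleA; congr (_ * _).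
  by rewrite muleC.
rewrite -ge0_integral_fsum//; last 2 first.
- by move=> r; apply: emeasurable_funM => //; apply/measurable_EFinP/measurable_funM => //.
- by move=> r x _; rewrite mule_ge0// EFinM nnfun_muleindic_ge0.
apply: eq_integral => x _.
rewrite -ge0_mule_fsuml; last by move=> r; rewrite EFinM nnfun_muleindic_ge0.
by rewrite [in RHS]fimfunE -fsumEFin.
Qed.

Lemma ge0_integral_density (f : T -> \bar R) : (forall x, 0 <= f x) ->
  measurable_fun setT f -> \int[nu]_x f x = \int[mu]_x (f x * w x).
Proof.
move=> f0 mf; pose g := nnsfun_approx measurableT mf.
have mg n : measurable_fun setT (EFin \o g n) by exact/measurable_EFinP.
have ndg x : {homo (fun n => (g n x)%:E) : n m / (n <= m)%N >-> n <= m}.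
  by move=> n m nm; rewrite lee_fin; exact/lefP/nd_nnsfun_approx.
have cg x : (g n x)%:E @[n --> \oo] --> f x by exact: cvg_nnsfun_approx.
transitivity (limn (fun n => \int[nu]_x (g n x)%:E)).
  rewrite -monotone_convergence//; last first.
    by move=> n x _; rewrite lee_fin.
  by apply: eq_integral => x _; apply/esym/cvg_lim => //; exact: cg.
transitivity (limn (fun n => \int[mu]_x ((g n x)%:E * w x))).
  by apply: congr_lim; apply/funext => n; exact: integral_density_nnsfun.
rewrite -monotone_convergence//; last 3 first.
- by move=> n; apply: emeasurable_funM; [exact: mg|exact: mw].
- by move=> n x _; rewrite mule_ge0// lee_fin.
- by move=> x _ n m nm; rewrite lee_wpmul2r//; exact: ndg.
apply: eq_integral => x _; apply/cvg_lim => //.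
have gf n : (g n x)%:E <= f x.
  by apply: (cvge_ge _ (cg x)); near=> m; apply: ndg; near: m; exact: nbhs_infty_ge.
(* Densities may be infinite, so the points where a factor vanishes are treated apart: the extended
   product is not continuous at 0 times infinity. *)
have [wx0|wx0] := eqVneq (w x) 0.
  by rewrite wx0 mule0; under eq_fun do rewrite mule0; exact: cvg_cst.
have [fx0|fx0] := eqVneq (f x) 0.
  rewrite fx0 mul0e (_ : (fun n => _) = cst 0); first exact: cvg_cst.
  apply/funext => n /=; rewrite (_ : (g n x)%:E = 0) ?mul0e//.
  by apply/eqP; rewrite eq_le; apply/andP; split; [have := gf n; rewrite fx0|rewrite lee_fin].
apply: cvgeM; [|exact: cg|exact: cvg_cst].
by apply: neq0_mule_def; rewrite mule_eq0 negb_or fx0.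
Unshelve. all: by end_near. Qed.

End IntegralDensity.

(** * Overlap of densities and uniform mixing *)

Section MarkovOrbitSum.
Context d (T : measurableType d) (R : realType).
Variable k : T -> probability T R.
Hypothesis mk : measurable_family k.

Lemma markov_orbit_sumE n f x : unit_fun f ->
  markov k (orbit_sum k n f) x = \sum_(i < n) iter i.+1 (markov k) f x.
Proof.
move=> uf; elim: n => [|n IH]; first by rewrite orbit_sum0 markov_cst big_ord0.
rewrite orbit_sumS markovD; first by rewrite IH big_ord_recr.
- exact: orbit_sum_bmf.
- by apply: unit_fun_bmf; exact: iter_markov_unit.
Qed.

End MarkovOrbitSum.

Section Overlap.
Context (R : realType) (G : ptopologicalType) (S : semigroupoid G).
Hypothesis hS : locally_compact_semigroupoid S.
Notation B := (borelType G).
Local Open Scope ereal_scope.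
Variables (lambda : G -> {measure set B -> \bar R}) (pi : G -> probability B R)
  (k : B -> probability B R) (K : nat -> B -> probability B R)
  (D : G * G -> \bar R).
Hypotheses (lambda_sfin : forall g, sigma_finite setT (lambda (tgt S g)))
  (pi_cs : continuous_system S pi) (kP : translation_kernel S pi k)
  (KP : iterates k K)
  (mD : measurable_fun [set: B * B] D) (DP : joint_RN_derivative S pi lambda D).

Let mk := translation_kernel_measurable hS pi_cs kP.
Let dens := density K D.
Let dens_ge0 n p : 0 <= dens n p. Proof. exact: (density_ge0 K DP). Qed.

Let mdens n g : measurable_fun [set: B] (fun e => dens n (g, e)).
Proof. exact: (measurable_density_slice hS pi_cs kP KP mD DP). Qed.

Definition density_sum n (p : G * G) : \bar R := \sum_(i < n) dens i p.

Lemma density_sum_ge0 n p : 0 <= density_sum n p.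
Proof. by apply: sume_ge0. Qed.

Lemma measurable_density_sum n : measurable_fun [set: B * B] (density_sum n).
Proof.
by apply: emeasurable_sum => i; exact: (measurable_density hS pi_cs kP KP mD DP).
Qed.

Lemma measurable_density_sum_slice n g :
  measurable_fun [set: B] (fun e => density_sum n (g, e)).
Proof. by apply: emeasurable_sum => i; exact: mdens. Qed.

Lemma integral_density_sum n g f : unit_fun (f : B -> R) ->
  \int[lambda (tgt S g)]_e ((f e)%:E * density_sum n (g, e)) =
  (markov k (orbit_sum k n f) g)%:E.
Proof.
move=> uf; have [mf f01] := uf; have f0 e : 0 <= (f e)%:E.
  by rewrite lee_fin; have /andP[] := f01 e.
have mfE : measurable_fun [set: B] (EFin \o f) by exact/measurable_EFinP.
rewrite (markov_orbit_sumE mk)// -sumEFin.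
under eq_integral do rewrite ge0_sume_distrr//.
rewrite ge0_integral_sum//; last 2 first.
- by move=> i; apply: emeasurable_funM => //; exact: mdens.
- by move=> i e _; rewrite mule_ge0.
apply: eq_bigr => i _; rewrite -(iterates_markov mk KP _ _ uf).
apply/esym/ge0_integral_density => //.
by move=> A mA; exact: (iterates_density hS lambda_sfin pi_cs kP KP mD DP).
Qed.

Lemma integral_density_sumT n g : \int[lambda (tgt S g)]_e density_sum n (g, e) = n%:R%:E.
Proof.
have u1 : unit_fun (cst 1%R : B -> R).
  by split; [exact: measurable_cst|move=> x; rewrite /= lexx ler01].
have := integral_density_sum n g u1.
under eq_integral do rewrite mul1e.
move=> ->; congr EFin; rewrite (markov_orbit_sumE mk)//.
rewrite (eq_bigr (fun=> 1%R)) ?sumr_const ?card_ord// => i _.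
have it m : iter m (markov k) (cst 1%R) = cst 1%R.
  by elim: m => //= m ->; apply/funext => x; exact: markov_cst.
by rewrite it.
Qed.

(** [n] minus this integral is the best [c] in [mixed k n c (tgt S g) g]. The common part of the
    densities is used because minima and integrals preserve lower semicontinuity, while differences
    do not. *)
Definition overlap n (g : G) : \bar R :=
  \int[lambda (tgt S g)]_e mine (density_sum n (tgt S g, e)) (density_sum n (g, e)).

Let mmin n g : measurable_fun [set: B]
  (fun e => mine (density_sum n (tgt S g, e)) (density_sum n (g, e))).
Proof. by apply: measurable_mine; exact: measurable_density_sum_slice. Qed.

Let min_ge0 n g e : 0 <= mine (density_sum n (tgt S g, e)) (density_sum n (g, e)).
Proof. by rewrite le_min !density_sum_ge0. Qed.

Let tgtK g : tgt S (tgt S g) = tgt S g.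
Proof. exact/tgt_unit/units_tgt. Qed.

(** The extremal test function is the indicator of the set [A] where the density from [tgt S g] is
    the larger one: the minimum is [b] on [A] and [a] off it. *)
Lemma mixed_overlap n c g : mixed k n c (tgt S g) g -> (n%:R - c)%:E <= overlap n g.
Proof.
pose a e := density_sum n (tgt S g, e); pose b e := density_sum n (g, e).
have ma : measurable_fun [set: B] a by exact: measurable_density_sum_slice.
have mb : measurable_fun [set: B] b by exact: measurable_density_sum_slice.
have a0 e : 0 <= a e by exact: density_sum_ge0.
have b0 e : 0 <= b e by exact: density_sum_ge0.
pose A := [set e : B | b e < a e].
have mA : measurable A by rewrite -[A]setTI; exact: emeasurable_fun_lt.
have uA : unit_fun (\1_A : B -> R).
  split; first exact: measurable_indic.
  by move=> x; rewrite indicE; case: (_ \in _); rewrite /= ?lexx ler01.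
have mIA : measurable_fun [set: B] (fun e => (\1_A e)%:E : \bar R).
  by apply/measurable_EFinP; exact: measurable_indic.
have mIC : measurable_fun [set: B] (fun e => (\1_(~` A) e)%:E : \bar R).
  by apply/measurable_EFinP; apply: measurable_indic; exact: measurableC.
move=> /(_ _ uA); rewrite -lee_fin EFinD -!integral_density_sum// tgtK -/a -/b => h.
have <- : \int[lambda (tgt S g)]_e ((\1_A e)%:E * b e) +
    \int[lambda (tgt S g)]_e ((\1_(~` A) e)%:E * a e) = overlap n g.
  rewrite -ge0_integralD//; last 4 first.
  - by move=> e _; rewrite mule_ge0.
  - exact: emeasurable_funM.
  - by move=> e _; rewrite mule_ge0.
  - exact: emeasurable_funM.
  apply: eq_integral => e _; rewrite !indicE in_setC -/(a e) -/(b e).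
  have [|] := boolP (e \in A); rewrite /= ?mul0e mul1e ?adde0 ?add0e.
    by rewrite inE => /ltW ba; rewrite (min_idPr ba).
  by rewrite notin_setE => /negP; rewrite -leNgt => ab; rewrite (min_idPl ab).
have aE : \int[lambda (tgt S g)]_e ((\1_A e)%:E * a e) +
    \int[lambda (tgt S g)]_e ((\1_(~` A) e)%:E * a e) = n%:R%:E.
  rewrite -(integral_density_sumT n (tgt S g)) tgtK -ge0_integralD//; last 4 first.
  - by move=> e _; rewrite mule_ge0.
  - exact: emeasurable_funM.
  - by move=> e _; rewrite mule_ge0.
  - exact: emeasurable_funM.
  apply: eq_integral => e _; rewrite !indicE in_setC.
  by case: (e \in A); rewrite /= mul0e mul1e ?adde0 ?add0e.
rewrite EFinB leeBlDr// -aE; apply: le_trans (leeD2r _ h) _.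
by rewrite addeAC.
Qed.

(** Pointwise, [f a + min(a, b) <= a + f b] for [f] in [0, 1]; the additive form avoids subtracting
    densities, which may be infinite. *)
Lemma overlap_mixed n c g : (n%:R - c)%:E <= overlap n g -> mixed k n c (tgt S g) g.
Proof.
pose a e := density_sum n (tgt S g, e); pose b e := density_sum n (g, e).
have ma : measurable_fun [set: B] a by exact: measurable_density_sum_slice.
have mb : measurable_fun [set: B] b by exact: measurable_density_sum_slice.
have a0 e : 0 <= a e by exact: density_sum_ge0.
have b0 e : 0 <= b e by exact: density_sum_ge0.
move=> h f uf; have [mf f01] := uf.
have f0 e : 0 <= (f e)%:E by rewrite lee_fin; have /andP[] := f01 e.
have f1 e : 0 <= (1 - f e)%:E by rewrite lee_fin subr_ge0; have /andP[] := f01 e.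
have mfE : measurable_fun [set: B] (fun e => (f e)%:E) by exact/measurable_EFinP.
have mf1 : measurable_fun [set: B] (fun e => (1 - f e)%:E).
  by apply/measurable_EFinP; apply: measurable_funB => //; exact: measurable_cst.
have Ea := integral_density_sum n (tgt S g) uf; rewrite tgtK in Ea.
have Eb := integral_density_sum n g uf.
have key : \int[lambda (tgt S g)]_e ((f e)%:E * a e) + overlap n g <=
    n%:R%:E + \int[lambda (tgt S g)]_e ((f e)%:E * b e).
  rewrite -(integral_density_sumT n (tgt S g)) tgtK.
  rewrite -!ge0_integralD//; last 5 first.
  - by move=> e _; exact: density_sum_ge0.
  - by move=> e _; rewrite mule_ge0.
  - exact: emeasurable_funM.
  - by move=> e _; rewrite mule_ge0.
  - exact: emeasurable_funM.
  apply: ge0_le_integral => //.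
  - by move=> e _; rewrite adde_ge0// mule_ge0.
  - by apply: emeasurable_funD => //; exact: emeasurable_funM.
  - by apply: emeasurable_funD => //; exact: emeasurable_funM.
  move=> e _; rewrite -/(a e) -/(b e).
  have sum1 x : 0 <= x -> (f e)%:E * x + (1 - f e)%:E * x = x.
    by move=> x0; rewrite -ge0_muleDl// -EFinD addrC subrK mul1e.
  rewrite -[in leRHS](sum1 (a e))// -addeA leeD2l//.
  have m0 : 0 <= mine (a e) (b e) by rewrite le_min a0 b0.
  rewrite -(sum1 _ m0) addeC leeD//.
    by rewrite lee_wpmul2l// ge_min lexx orbT.
  by rewrite lee_wpmul2l// ge_min lexx ?orbT.
move: key => /(le_trans (leeD2l _ h)).
by rewrite Ea Eb -!EFinD lee_fin; lra.
Qed.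

Hypotheses (lD : lower_semicontinuous D) (lambda_cs : continuous_system S lambda).

Let ctsS : continuous (src S). Proof. by have [[]] := hS. Qed.
Let cttS : continuous (tgt S). Proof. by have [[]] := hS. Qed.
Let lcG : locally_compact [set: G]. Proof. by have [] := hS. Qed.
Let hG : hausdorff_space G. Proof. by have [] := hS. Qed.
Let scG : @second_countable G. Proof. by have [] := hS. Qed.

Lemma density_lsc n : lower_semicontinuous (dens n).
Proof.
case: n => [|n] //=.
have lK : lsc_family (fun p : G * G => K n p.1).
  have lKn : lsc_family (fun g : G => K n g) by exact: (iterates_lsc hS pi_cs kP KP).
  move=> V oV; apply: (@lsc_comp R G (G * G)%type fst (fun g => K n g V)).
    by move=> p; exact: cvg_fst.
  exact: lKn.
apply: (lsc_integral lcG hG scG (h := fun q : (G * G) * G => D (q.2, q.1.2)) lK).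
  by move=> q; exact: (dens_ge0 0).
apply: (lsc_comp (c := fun q : (G * G) * G => (q.2, q.1.2))) lD => q.
apply: cvg_pair; first exact: cvg_snd.
by apply: cvg_comp; [exact: cvg_fst|exact: cvg_snd].
Qed.

Lemma overlap_lsc n : lower_semicontinuous (overlap n).
Proof.
have ll := continuous_system_lsc lcG hG scG cttS (@units_tgt _ S) lambda_cs.
have lsum : lower_semicontinuous (density_sum n).
  by apply: lsc_sum => // i; exact: density_lsc.
apply: (lsc_integral lcG hG scG (mu := fun g => lambda (tgt S g))
  (h := fun p => mine (density_sum n (tgt S p.1, p.2)) (density_sum n p)) ll).
  by move=> [g e]; exact: min_ge0.
apply: lsc_mine => //.
apply: (lsc_comp (c := fun p : G * G => (tgt S p.1, p.2))) lsum => p.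
apply: cvg_pair; last exact: cvg_snd.
by apply: cvg_comp; [exact: cvg_fst|exact: cttS].
Qed.

(** The room between [c] and [e] turns the bound at [g] into the strict inequality that lower
    semicontinuity propagates. *)
Lemma mixed_near n c e g : (c < e)%R -> mixed k n c (tgt S g) g ->
  \forall z \near g, mixed k n e (tgt S z) z.
Proof.
move=> ce /mixed_overlap h.
have [|V Vg VE] := @overlap_lsc n g (n%:R - e)%R.
  by apply: lt_le_trans h; rewrite lte_fin ltrD2l ltrN2.
by apply: filterS Vg => z /VE /ltW /overlap_mixed.
Qed.

Lemma mixed_uniform (C : set G) (e : R) : compact C -> (0 < e)%R ->
  (forall g (c : R), (0 < c)%R -> exists N, forall n, (N <= n)%N ->
     mixed k n (n%:R * c) (tgt S g) g) ->
  exists N, forall n, (N <= n)%N -> forall g, C g -> mixed k n (n%:R * e) (tgt S g) g.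
Proof.
move=> cC e0 pointwise.
apply: (compact_union_ind (Q := fun A => exists N, forall n, (N <= n)%N ->
  forall g, A g -> mixed k n (n%:R * e) (tgt S g) g) cC).
- by exists 0%N.
- move=> A A' [N hN] [N' hN']; exists (maxn N N') => n; rewrite geq_max => /andP[Nn N'n].
  by move=> g [Ag|A'g]; [exact: hN|exact: hN'].
- by move=> A A' AA' [N hN]; exists N => n Nn g /AA'; exact: hN.
(* Rate [e / 4] at [g] becomes [e / 2] nearby for the fixed length [m]; the other half of [e]
   absorbs the remainder [m] of [mixed_large] from a rank [M] that is the same for all nearby
   points. *)
move=> g _; have e4 : (0 < e / 4)%R by rewrite divr_gt0.
have [N hN] := pointwise g _ e4.
have := hN N.+1 (leqnSn N); set m := N.+1 => hm.
exists [set z | mixed k m (m%:R * (e / 2)) (tgt S z) z].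
  by apply: mixed_near hm; rewrite ltr_pM2l ?ltr0n//; lra.
have [M Mm] : exists M : nat, (m%:R <= M%:R * (e / 2))%R.
  exists (Num.truncn (m%:R / (e / 2))).+1.
  by rewrite -ler_pdivrMr ?divr_gt0// ltW// truncnS_gt.
exists M => n Mn z /= hz.
have e2 : (0 <= e / 2)%R by rewrite divr_ge0// ltW.
apply: mixed_mono (mixed_large mk n (ltn0Sn N) e2 hz).
have : (M%:R * (e / 2) <= n%:R * (e / 2))%R by rewrite ler_wpM2r// ler_nat.
rewrite -/m; lra.
Qed.

End Overlap.

(** * Cesaro averages and the Reiter property *)

Section TotalVariation.
Context (R : realType) (G : ptopologicalType).
Notation B := (borelType G).

(** Grouping the pieces by the sign of the difference leaves two sets, whence the factor 2; the
    lower bound is the upper bound on complements, both total masses being 1. *)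
Lemma tv_norm_le (p q : probability B R) (nu : set B -> \bar R) (e : R) :
  (forall A, measurable A -> nu A = q A) ->
  (forall A, measurable A -> (p A <= q A + e%:E)%E) ->
  (tv_norm (fun A => p A - nu A) <= (2 * e)%:E)%E.
Proof.
move=> nuq pq; apply: ge_ereal_sup => _ [n [A [mA tA ->]]].
have pfin X : measurable X -> p X = (fine (p X))%:E by move=> mX; rewrite fineK// fin_num_measure.
have qfin X : measurable X -> q X = (fine (q X))%:E by move=> mX; rewrite fineK// fin_num_measure.
pose d X := fine (p X) - fine (q X).
have d_le X : measurable X -> d X <= e.
  by move=> mX; have := pq _ mX; rewrite pfin// qfin// -EFinD lee_fin /d; lra.
have d_ge X : measurable X -> - e <= d X.
  move=> mX; have := d_le _ (measurableC mX).
  by rewrite /d !probability_setC// pfin// qfin//=; lra.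
have dU (P : pred 'I_n) : d (\big[setU/set0]_(i < n | P i) A i) = \sum_(i < n | P i) d (A i).
  rewrite /d sumrB; congr (_ - _).
    rewrite measure_bigsetU_ord_cond//; last exact: sub_trivIset tA.
    rewrite (eq_bigr (fun i => (fine (p (A i)))%:E)); last by move=> i _; exact: pfin.
    by rewrite sumEFin.
  rewrite measure_bigsetU_ord_cond//; last exact: sub_trivIset tA.
  rewrite (eq_bigr (fun i => (fine (q (A i)))%:E)); last by move=> i _; exact: qfin.
  by rewrite sumEFin.
have mU (P : pred 'I_n) : measurable (\big[setU/set0]_(i < n | P i) A i).
  exact: bigsetU_measurable.
rewrite (eq_bigr (fun i => `|d (A i)|%:E)); last first.
  by move=> i _; rewrite nuq// pfin// qfin.
rewrite sumEFin lee_fin (bigID (fun i => 0 <= d (A i)))/=.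
rewrite (eq_bigr (fun i => d (A i))); last by move=> i; exact: ger0_norm.
rewrite [X in _ + X](eq_bigr (fun i => - d (A i))); last first.
  by move=> i; rewrite -ltNge => /ltr0_norm.
rewrite sumrN -!dU; have := d_le _ (mU (fun i => 0 <= d (A i))).
by have := d_ge _ (mU (fun i => ~~ (0 <= d (A i)))); lra.
Qed.

End TotalVariation.

Lemma exists_cesaro d (T : measurableType d) (R : realType)
    (K : nat -> T -> probability T R) :
  exists theta : nat -> T -> probability T R, forall n x A,
    (theta n x A = (n.+1%:R^-1)%:E * \sum_(j < n.+1) K j x A)%E.
Proof.
have c0 n : 0 <= n.+1%:R^-1 :> R by rewrite invr_ge0.
have h (nx : nat * T) : exists nu : probability T R, forall A,
    (nu A = (nx.1.+1%:R^-1)%:E * \sum_(j < nx.1.+1) K j nx.2 A)%E.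
  pose m : {measure set T -> \bar R} :=
    mscale (NngNum (c0 nx.1)) (msum (fun j => K j nx.2) nx.1.+1).
  have mE A : (m A = (nx.1.+1%:R^-1)%:E * \sum_(j < nx.1.+1) K j nx.2 A)%E by [].
  have [nu nuE] : exists nu : probability T R, forall A, nu A = m A.
    apply: probability_of_measure; rewrite mE.
    rewrite (eq_bigr (fun=> 1%:E)); last by move=> i _; exact: probability_setT.
    by rewrite sumEFin sumr_const card_ord -EFinM mulVf.
  by exists nu => A; rewrite nuE.
have [theta thetaE] := choice h.
by exists (fun n x => theta (n, x)) => n x A; rewrite thetaE.
Qed.

(** * Supports and tightness *)

Section Support.
Context (R : realType) (G : ptopologicalType) (S : semigroupoid G).
Hypothesis hS : locally_compact_semigroupoid S.
Notation B := (borelType G).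

Let ctsS : continuous (src S). Proof. by have [[]] := hS. Qed.
Let cttS : continuous (tgt S). Proof. by have [[]] := hS. Qed.
Let hG : hausdorff_space G. Proof. by have [] := hS. Qed.
Let scG : @second_countable G. Proof. by have [] := hS. Qed.

(** Each point off the support has a null basic open neighbourhood, and there are only countably
    many of these. *)
Lemma msupport_conull (mu : {measure set B -> \bar R}) :
  exists N : set B, [/\ measurable N, mu N = 0%E & ~` msupport mu `<=` N].
Proof.
have [b cb [bo bB]] := scG.
pose D := [set U | b U /\ mu U = 0%E].
have cD : countable D by apply: sub_countable cb; apply: subset_card_le => U [].
have [N NE NU] : exists2 N : nat -> set G, forall n, open (N n) /\ mu (N n) = 0%E &
    forall U, D U -> exists n, U = N n.
  have [D0|/set0P D0] := eqVneq D set0.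
    exists (fun=> set0); first by move=> _; split; [exact: open0|exact: measure0].
    by rewrite D0.
  have /pfcard_geP[De|[e]] := cD; first by move: D0; rewrite De => -[].
  exists e.
    move=> n; have [bn mn] : D (e n) by apply: (@funS _ _ _ _ e).
    by split => //; exact: bo.
  by move=> U DU; have [n _ en] := @surj _ _ _ _ e U DU; exists n.
have mN n : measurable (N n : set B) by apply: open_borel; have [] := NE n.
exists (\bigcup_n N n); split.
- exact: bigcupT_measurable.
- apply/eqP; rewrite -measure_le0.
  apply: (@le_trans _ _ (\sum_(0 <= n <oo) mu (N n))%E).
    by apply: measure_sigma_subadditive => //; exact: bigcupT_measurable.
  by rewrite eseries0// => n *; have [] := NE n.
- move=> y /existsNP[U /not_implyP[oU /not_implyP[Uy /negP]]].
  rewrite -leNgt => U0.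
  have [V [bV Vy] VU] := bB y U (open_nbhs_nbhs (conj oU Uy)).
  have [n Vn] : exists n, V = N n.
    apply: NU; split => //; apply/eqP; rewrite -measure_le0 (le_trans _ U0)//.
    by apply: le_measure; rewrite ?inE//; apply: open_borel => //; exact: bo.
  by exists n => //; rewrite -Vn.
Qed.

Lemma composable_closed : closed (composable S).
Proof.
rewrite -openC openE => -[g e] /= /eqP ne.
have := hG; rewrite open_hausdorff => /(_ _ _ ne)[[U V] /= [gU eV] [oU oV /eqP UV]].
rewrite !inE in gU eV.
exists (src S @^-1` U, tgt S @^-1` V) => /=.
  by split; [apply: ctsS|apply: cttS]; exact: open_nbhs_nbhs.
move=> [a c] /= [Ua Vc] ac; have : (U `&` V) (src S a) by split => //; rewrite ac.
by rewrite UV.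
Qed.

Lemma compact_comp (L M : set G) : compact L -> compact M ->
  compact [set comp S p.1 p.2 | p in (L `*` M) `&` composable S].
Proof.
move=> cL cM; have [[_ _ cc] _ _ _] := hS.
apply: (@continuous_compact _ _ (fun p : G * G => comp S p.1 p.2)).
  by apply: continuous_subspaceW cc; exact: subIsetr.
apply: (subclosed_compact _ (compact_setX cL cM)); last exact: subIsetl.
apply: closedI; last exact: composable_closed.
have -> : L `*` M = fst @^-1` L `&` snd @^-1` M by [].
apply: closedI; apply: closed_comp; try exact: compact_closed.
- by move=> p _; exact: cvg_fst.
- by move=> p _; exact: cvg_snd.
Qed.

Variables (pi : G -> probability B R) (k : B -> probability B R)
  (K : nat -> B -> probability B R).
Hypotheses (pi_cs : continuous_system S pi) (kP : translation_kernel S pi k)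
  (KP : iterates k K) (pi_tight : tight S pi).

Let mk := translation_kernel_measurable hS pi_cs kP.

(** A step from [z] in [L] multiplies [z] by an element of the support of [pi (src S z)]; tightness
    over the compact image of [L] under [src S] keeps all these products in one compact set. *)
Lemma tight_translation_kernel (L : set G) : compact L ->
  exists2 L', compact L' & forall z, L z -> k z (~` L') = 0%E.
Proof.
move=> cL.
have cC : compact (src S @` L).
  by apply: continuous_compact => //; exact: continuous_subspaceT.
have CU : src S @` L `<=` units S by move=> _ [z _ <-]; exact: units_src.
have cM := pi_tight CU cC; set M := supp_over _ _ in cM.
pose L' := [set comp S p.1 p.2 | p in (L `*` M) `&` composable S].
have cL' : compact L' := compact_comp cL cM; exists L' => // z Lz.
have mL' := compact_borel hG cL'.
rewrite (translation_kernelE hS pi_cs kP); last exact: measurableC.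
have [N [mN N0 NS]] := msupport_conull (pi (src S z)).
rewrite /translate; apply: (subset_measure0 _ mN _ N0).
  rewrite (_ : _ `&` _ = fiber S (src S z) `&` left_mul S z @^-1` (~` L')).
    apply: measurableI; first exact: fiber_borel.
    rewrite -[X in measurable X]setTI.
    by apply: (measurable_left_mul hS) => //; exact: measurableC.
  by apply/seteqP; split => e [/= te]; rewrite left_mulE.
move=> e [/= te nLe]; apply: NS => se; apply: nLe; exists (z, e) => //=.
split; last exact: esym.
split => //=; apply: subset_closure; exists (src S z) => //.
Qed.

Lemma tight_iterates (C : set G) n : compact C ->
  exists2 L, compact L & forall x, C x -> K n x (~` L) = 0%E.
Proof.
move=> cC; have [K0 _] := KP; elim: n => [|n [L cL hL]].
  by have [L cL hL] := tight_translation_kernel cC; exists L => // x Cx; rewrite K0 hL.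
have [L' cL' hL'] := tight_translation_kernel cL; exists L' => // x Cx.
have mL := compact_borel hG cL; have mL' := measurableC (compact_borel hG cL').
rewrite (iteratesE KP)// (eq_integral_conull mL (g := cst 0%E))//.
- by rewrite integral0.
- exact: hL.
- exact: mk.
Qed.

(** Each power involved puts no mass outside a compact set common to all starting points in [C]. The
    finite union of these sets is closed, so it contains the supports and the closure of their
    union. *)
Lemma tight_cesaro (theta : nat -> G -> probability B R) n :
  (forall n x A, theta n x A = (n.+1%:R^-1)%:E * \sum_(j < n.+1) K j x A)%E ->
  tight S (theta n).
Proof.
move=> thetaE C CU cC.
have /choice[L LP] j : exists L, compact L /\ forall x, C x -> K j x (~` L) = 0%E.
  by have [L cL hL] := tight_iterates j cC; exists L.
pose M := \big[setU/set0]_(j < n.+1) L j.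
have cM : compact M by apply: bigsetU_compact => j _; have [] := LP j.
have clM := compact_closed hG cM.
apply: (subclosed_compact (@closed_closure _ _) cM).
rewrite [X in _ `<=` X]((closure_id M).1 clM); apply: closureS => y [x Cx].
apply: contraPP => nMy /(_ (~` M) (closed_openC clM) nMy).
suff t0 : (theta n x (~` M) <= 0)%E by move/lt_le_trans => /(_ _ t0); rewrite ltxx.
rewrite thetaE big1 ?mule0// => j _; have [cL hL] := LP j.
have mL := measurableC (compact_borel hG cL).
apply: (subset_measure0 _ mL _ (hL x Cx)).
  by apply: measurableC; exact: compact_borel.
by apply: subsetC; exact: (bigsetU_sup (i := j)).
Qed.

End Support.

(** * Mixing for a Liouville system *)

Section Liouville.
Context (R : realType) (G : ptopologicalType) (S : semigroupoid G).
Hypothesis hS : locally_compact_semigroupoid S.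
Notation B := (borelType G).
Variables (lambda : G -> {measure set B -> \bar R}) (pi : G -> probability B R)
  (k : B -> probability B R) (K : nat -> B -> probability B R).
Hypotheses (lambda_cs : continuous_system S lambda)
  (pi_liouville : liouville_system S lambda pi) (kP : translation_kernel S pi k)
  (KP : iterates k K).

Let pi_cs : continuous_system S pi. Proof. by have [[]] := pi_liouville. Qed.
Let mk := translation_kernel_measurable hS pi_cs kP.

Lemma unit_fun_Lfun (mu : {measure set B -> \bar R}) (h : B -> R) :
  unit_fun h -> h \in Lfun mu +oo%E.
Proof.
move=> [mh h01]; apply/andP; split; rewrite inE//=.
rewrite /finite_norm unlock /=; case: ifPn => // _.
apply: (@le_lt_trans _ _ 1%E); last by rewrite ltry.
apply/ess_supP; apply: nearW => x /=.
by have /andP[h0 h1] := h01 x; rewrite lee_fin ger0_norm.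
Qed.

(** [averaging] integrates over the fiber, [markov k] uses the total map [left_mul]; they agree
    because the measure sits on the fiber. This links the harmonic functions of the definition to
    those of [liouville_mixed]. *)
Lemma averaging_markov (h : B -> R) z : unit_fun h ->
  averaging S pi (fun y => Complex (h y) 0) z = Complex (markov k h z) 0.
Proof.
move=> uh; have [mh h01] := uh.
have h0 y : (0 <= (h y)%:E)%E by rewrite lee_fin; have /andP[] := h01 y.
have mhE : measurable_fun [set: B] (EFin \o h) by exact/measurable_EFinP.
rewrite /averaging /=; congr Complex; last by rewrite Rintegral_cst ?mul0r//; exact: fiber_borel.
rewrite /markov /Rintegral; congr fine.
rewrite (kP z h0 mhE) integral_mkcond.
have [pi_z _] := pi_cs; have [p0 _ _ _] := pi_z _ (units_src S z).
have -> : (\int[pi (src S z)]_y (h (left_mul S z y))%:E =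
    \int[pi (src S z)]_y pullback S z (EFin \o h) y)%E.
  apply: (eq_integral_conull (fiber_borel hS (src S z)) p0).
  - by apply: (measurableT_comp mhE); exact: measurable_left_mul.
  - exact: measurable_pullback.
  - by move=> y; exact: h0.
  - by move=> y; exact: pullback_ge0.
  - by move=> y /= ty; rewrite /pullback ty eqxx left_mulE.
apply: eq_integral => y _; rewrite patchE /pullback.
case: ifPn => [|/negP]; rewrite inE /fiber /=; first by move=> ->; rewrite eqxx.
by move=> /eqP/negbTE ->.
Qed.

Lemma harmonic_constant x (h : B -> R) : units S x -> unit_fun h ->
  {ae lambda x, forall z, markov k h z = h z} ->
  exists c, {ae lambda x, forall z, h z = c}.
Proof.
move=> ux uh hh; have [_ /(_ x ux) HC] := pi_liouville.
have : Defs.harmonic S lambda pi x (fun y => Complex (h y) 0).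
  split.
    split; first exact: unit_fun_Lfun.
    by apply: unit_fun_Lfun; split => [|y] /=; [exact: measurable_cst|rewrite lexx ler01].
  by apply: filterS hh => z hz; rewrite averaging_markov// hz.
rewrite HC => -[_ [c [N [mN N0 hN]]]]; exists (complex.Re c), N; split => // z nz.
by apply: hN => /= hz; apply: nz; rewrite -hz.
Qed.

Hypothesis lambda_dom : forall n g (A : set B), measurable A ->
  lambda (tgt S g) A = 0%E -> K n g A = 0%E.

(** Both [tgt S g] and [g] lie in the fiber over [tgt S g], so the measure on that fiber serves as
    the reference for both starting points. *)
Lemma liouville_system_mixed g (e : R) : 0 < e ->
  exists N, forall n, (N <= n)%N -> mixed k n (n%:R * e) (tgt S g) g.
Proof.
have [lam _] := lambda_cs; have [l0 _ lsf _] := lam _ (units_tgt S g).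
apply: (liouville_mixed mk lsf (fiber_borel hS (tgt S g)) l0).
- move=> z zF A mA A0; have [K0 _] := KP; rewrite -K0; apply: lambda_dom => //.
  by rewrite zF.
- by move=> h; exact: harmonic_constant (units_tgt S g).
- by apply: tgt_unit; exact: units_tgt.
- by [].
Qed.

End Liouville.

(** * The averages as adapted systems and their Reiter defect *)

Section Cesaro.
Context (R : realType) (G : ptopologicalType) (S : semigroupoid G).
Hypothesis hS : locally_compact_semigroupoid S.
Notation B := (borelType G).
Local Open Scope ereal_scope.
Variables (lambda : G -> {measure set B -> \bar R}) (pi : G -> probability B R)
  (k : B -> probability B R) (K : nat -> B -> probability B R)
  (D : G * G -> \bar R) (theta : nat -> G -> probability B R).
Hypotheses (lambda_cs : continuous_system S lambda)
  (pi_cs : continuous_system S pi) (kP : translation_kernel S pi k)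
  (KP : iterates k K)
  (mD : measurable_fun [set: B * B] D) (DP : joint_RN_derivative S pi lambda D)
  (thetaE : forall n x A, theta n x A = (n.+1%:R^-1)%:E * \sum_(j < n.+1) K j x A).

Let lcG : locally_compact [set: G]. Proof. by have [] := hS. Qed.
Let hG : hausdorff_space G. Proof. by have [] := hS. Qed.
Let scG : @second_countable G. Proof. by have [] := hS. Qed.

Let mk := translation_kernel_measurable hS pi_cs kP.

Let lambda_sfin g : sigma_finite setT (lambda (tgt S g)).
Proof. by have [/(_ _ (units_tgt S g))[]] := lambda_cs. Qed.

Lemma cesaro_continuous_system n : continuous_system S (theta n).
Proof.
apply: lsc_family_continuous_system => //.
  move=> V oV; rewrite (_ : (fun x => _) =
      fun x => (n.+1%:R^-1)%:E * \sum_(j < n.+1) K j x V); last first.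
    by apply/funext => x; exact: thetaE.
  apply: lscZ; first by rewrite invr_gt0.
  apply: lsc_sum => // j; exact: (iterates_lsc hS pi_cs kP KP).
move=> x ux; apply: etrans; first exact: thetaE.
rewrite big1 ?mule0// => j _; rewrite -[in fiber S x](tgt_unit ux).
exact: (iterates_fiber hS pi_cs kP KP).
Qed.

Lemma cesaro_translate n g (A : set B) : measurable A ->
  translate S g (theta n (src S g)) A = theta n g A.
Proof.
move=> mA; rewrite /translate !thetaE; congr (_ * _); apply: eq_bigr => j _.
exact: (iterates_translate hS pi_cs kP KP).
Qed.

(** Translating by [g] gives the average started at [g], so the mean of the densities of [K 0] to
    [K n] is a joint density, measurable in both variables. *)
Lemma cesaro_adapted n : adapted S lambda (theta n).
Proof.
split; first exact: cesaro_continuous_system.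
  move=> x ux; apply/null_content_dominatesP => A mA A0.
  apply: etrans; first exact: thetaE.
  rewrite big1 ?mule0// => j _.
  apply: (iterates_dominated hS lambda_sfin pi_cs kP KP mD DP) => //.
  by rewrite tgt_unit.
have c0 : (0 <= n.+1%:R^-1 :> R)%R by rewrite invr_ge0.
have md g := measurable_density_sum_slice hS pi_cs kP KP mD DP n.+1 g.
have d0 g e : 0 <= density_sum K D n.+1 (g, e) by exact: (density_sum_ge0 K DP).
exists (fun p => (n.+1%:R^-1)%:E * density_sum K D n.+1 p).
  apply/(measurable_prod_borel scG); apply: measurable_funeM.
  exact: (measurable_density_sum hS pi_cs kP KP mD DP).
move=> g; split.
- by apply: measurable_funeM; exact: md.
- by move=> e; rewrite mule_ge0.
move=> A mA; rewrite cesaro_translate// thetaE ge0_integralZl//; last exact: measurable_funTS.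
congr (_ * _); rewrite ge0_integral_sum//; last 2 first.
- move=> j; apply: measurable_funTS.
  exact: (measurable_density_slice hS pi_cs kP KP mD DP).
- by move=> j e _; exact: (density_ge0 K DP).
by apply: eq_bigr => j _; exact: (iterates_density hS lambda_sfin pi_cs kP KP mD DP).
Qed.

Lemma cesaro_indic n x (A : set B) : measurable A ->
  theta n x A = (n.+1%:R^-1 * markov k (orbit_sum k n.+1 \1_A) x)%R%:E.
Proof.
move=> mA; have uA : unit_fun (\1_A : B -> R).
  by split => // y; rewrite indicE; case: (y \in A); rewrite !lexx ler01.
rewrite thetaE (markov_orbit_sumE mk)// EFinM -sumEFin; congr (_ * _).
apply: eq_bigr => j _.
by rewrite -(iterates_markov mk KP)// integral_indicT.
Qed.

(** [theta n] averages the powers 1 to [n.+1], exactly those summed in [mixed] at length [n.+1];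
    dividing by [n.+1] leaves [e]. *)
Lemma cesaro_defect n g e : mixed k n.+1 (n.+1%:R * e) (tgt S g) g ->
  reiter_defect S (theta n) g <= (2 * e)%:E.
Proof.
move=> mix; apply: (tv_norm_le (q := theta n g)) => A mA; first exact: cesaro_translate.
rewrite !cesaro_indic// -EFinD lee_fin.
have uA : unit_fun (\1_A : B -> R).
  by split => // y; rewrite indicE; case: (y \in A); rewrite !lexx ler01.
have -> : e = (n.+1%:R^-1 * (n.+1%:R * e))%R by rewrite mulKf.
by rewrite -mulrDr ler_pM2l ?invr_gt0//; exact: mix.
Qed.

Lemma reiter_defect_ge0 n g : 0 <= reiter_defect S (theta n) g.
Proof.
apply: ereal_sup_ubound; exists 0%N, (fun=> set0); split => //; last by rewrite big_ord0.
by move=> i j _ _ [x []].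
Qed.

Lemma cesaro_reiter :
  (forall g (e : R), (0 < e)%R -> exists N, forall n, (N <= n)%N ->
    mixed k n (n%:R * e) (tgt S g) g) ->
  reiter_sequence S theta.
Proof.
move=> mix g.
(* The trivial mixing bound, at rate 1, makes the defect finite, so that convergence can be checked
   on real numbers. *)
have fin n : reiter_defect S (theta n) g \is a fin_num.
  rewrite ge0_fin_numE ?reiter_defect_ge0//.
  apply: (@le_lt_trans _ _ (2 * 1)%:E); last by rewrite ltry.
  by apply: cesaro_defect; rewrite mulr1; exact: mixed_trivial.
apply/fine_cvgP; split; first by apply: nearW.
apply/cvgrPdist_le => e e0; have [|N hN] := mix g (e / 2)%R; first exact: divr_gt0.
near=> n; rewrite sub0r normrN ger0_norm; last by rewrite fine_ge0 ?reiter_defect_ge0.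
rewrite -lee_fin fineK// (_ : e = (2 * (e / 2))%R); last by rewrite mulrC divfK.
apply: cesaro_defect; apply: hN; near: n; exists N => //= m /= Nm; exact: leqW.
Unshelve. all: by end_near. Qed.

Lemma cesaro_uniform_reiter :
  (forall (C : set G) (e : R), compact C -> (0 < e)%R -> exists N, forall n, (N <= n)%N ->
    forall g, C g -> mixed k n (n%:R * e) (tgt S g) g) ->
  uniform_reiter_sequence S theta.
Proof.
move=> mix C cC e e0; have [|N hN] := mix C (e / 4)%R cC; first exact: divr_gt0.
exists N => // n /= Nn g Cg; apply: (@le_lt_trans _ _ (2 * (e / 4))%:E); last first.
  by rewrite lte_fin; lra.
by apply: cesaro_defect; apply: hN => //; exact: leqW.
Qed.

End Cesaro.

Theorem theorem4p2 (R : realType) (G : ptopologicalType) (S : semigroupoid G)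
    (lambda : G -> {measure set (borelType G) -> \bar R})
    (hS : locally_compact_semigroupoid S)
    (hlambda : quasi_haar S lambda) :
  (liouville S lambda -> reiter S lambda) /\
  (tight_liouville S lambda -> tight_reiter S lambda) /\
  (continuous_liouville S lambda -> uniform_reiter S lambda).
Proof.
have [lambda_cs _ _] := hlambda; have [_ _ _ scG] := hS.
have lambda_sfin g : sigma_finite setT (lambda (tgt S g)).
  by have [/(_ _ (units_tgt S g))[]] := lambda_cs.
(* The three parts share the same averages and differ only in what is further known about [pi]. *)
have main pi : liouville_system S lambda pi ->
    exists (k : borelType G -> probability (borelType G) R)
      (K : nat -> borelType G -> probability (borelType G) R)
      (theta : nat -> G -> probability (borelType G) R),
    [/\ translation_kernel S pi k, iterates k K,
      forall n x A, (theta n x A = (n.+1%:R^-1)%:E * \sum_(j < n.+1) K j x A)%E,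
      forall n, adapted S lambda (theta n)
    & forall g (e : R), 0 < e -> exists N, forall n, (N <= n)%N ->
        mixed k n (n%:R * e) (tgt S g) g].
  move=> pi_l; have [[pi_cs _ [D mD DP]] _] := pi_l.
  have [k kP] := exists_translation_kernel hS pi.
  have mk := translation_kernel_measurable hS pi_cs kP.
  have [K KP] := exists_iterates mk.
  have [theta thetaE] := exists_cesaro K.
  have {}mD := (measurable_prod_borel scG _).1 mD.
  exists k, K, theta; split => //.
    exact: (cesaro_adapted hS lambda_cs pi_cs kP KP mD DP thetaE).
  apply: (liouville_system_mixed hS lambda_cs pi_l kP KP).
  exact: (iterates_dominated hS lambda_sfin pi_cs kP KP mD DP).
split; [|split].
- move=> [pi pi_l]; have [[pi_cs _ _] _] := pi_l.
  have [k [K [theta [kP KP thetaE adp mix]]]] := main pi pi_l.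
  by exists theta => //; exact: (cesaro_reiter hS pi_cs kP KP thetaE mix).
- move=> [pi pi_l pi_t]; have [[pi_cs _ _] _] := pi_l.
  have [k [K [theta [kP KP thetaE adp mix]]]] := main pi pi_l.
  exists theta; split => //; first exact: (cesaro_reiter hS pi_cs kP KP thetaE mix).
  by move=> n; exact: (tight_cesaro hS pi_cs kP KP pi_t thetaE).
- move=> [pi pi_l [D [cD _ DP]]]; have [[pi_cs _ _] _] := pi_l.
  have [k [K [theta [kP KP thetaE adp mix]]]] := main pi pi_l.
  (* [mixed] does not mention densities, so the pointwise rates, obtained in [main] from the Borel
     density, combine with the continuous version [D] in the semicontinuity argument. *)
  have lD : lower_semicontinuous (EFin \o D).
    move=> p a; rewrite lte_fin => ap; exists [set q | a < D q] => //.
    exact: (cD p _ (lt_nbhsr ap)).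
  have mD : measurable_fun [set: borelType G * borelType G] (EFin \o D).
    apply: (measurability _ (ErealGenOInfty.measurableE R)) => _ [_ [a ->] <-].
    rewrite setTI preimage_itvoy; apply: (open_prod_borel scG).
    exact: (lower_semicontinuousP _).1.
  exists theta => //; apply: (cesaro_uniform_reiter hS pi_cs kP KP thetaE) => C e cC e0.
  exact: (mixed_uniform hS lambda_sfin pi_cs kP KP mD DP lD lambda_cs cC e0 mix).
Qed.
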